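(* Let $\mathcal F$ be any class of joint distributions of $(Y,X)$ on $[0,1]^2$ such that any distribution in $\mathcal F$ satisfies the regularity conditions (i)–(vi) listed in the context, with constants $C_0,\overline C,\overline C',\underline C\in(0,\infty)$ and $C^*\in(0,2)$. Let $\mathit{data}$ be $n$ i.i.d. draws from $F_{Y,X}$, and define the minimax difference in the expected revenues $$\mathscr R_n^D(\mathcal F)=\inf_{\check p_D}\ \sup_{F_{Y,X}\in\mathcal F}\Big(R(p_D^*,F_{Y,X})-\mathbb E_{F_{Y,X}}\big[R(\check p_D(\cdot\,;\mathit{data}),F_{Y,X})\big]\Big),$$ where the infimum is over all data-based pricing strategies $\check p_D$ (all rules that map the sample $\mathit{data}$ to a measurable pricing function $\check p_D(\cdot\,;\mathit{data}):[0,1]\to[0,1]$). Then $\mathscr R_n^D(\mathcal F)=\Omega(n^{-1/2})$.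
   Context: Setting. $Y\in[0,1]$ is a buyer's valuation and $X\in[0,1]$ a covariate, with joint distribution $F_{Y,X}$, marginal density $f_X$ of $X$, conditional density $f_{Y|X}(y|x)$ and conditional CDF $F_{Y|X}(y|x)$. For $y,x\in[0,1]$, $r(y,x,F_{Y,X})=r(y,x)=y(1-F_{Y|X}(y|x))$. For a measurable pricing function $p:[0,1]\to[0,1]$, $R(p,F_{Y,X})=\int_0^1 r(p(x),x,F_{Y,X})f_X(x)\,dx$. The optimal pricing function $p_D^*=p_D^*(\cdot\,;F_{Y,X})$ maximizes $R(\cdot,F_{Y,X})$ over all measurable pricing functions; $p_D^*(x)$ is the maximizer of $r(\cdot,x)$ over $[0,1]$. $\mathbb E_{F_{Y,X}}$ is the expectation over $\mathit{data}\sim F_{Y,X}$. Regularity conditions on $F_{Y,X}$: (i) $|f_{Y|X}(y|x)-f_{Y|X}(y'|x)|\le C_0|y-y'|$ for all $y,y',x\in[0,1]$. (ii) The revenue function $r(y,x)$ is strictly concave (in $y$) with second-order derivative $-2f_{Y|X}(y|x)-y\,\partial_y f_{Y|X}(y|x)\le -C^*$ a.e. (iii) $p_D^*(x)\in(0,1)$ for each $x\in[0,1]$. (iv) $f_{Y|X}(y|x)$ is continuously differentiable in $(x,y)$ in a neighborhood of the curve $\{(x,p_D^*(x)):x\in[0,1]\}$. (v) $|2f_{Y|X}(y|x)+y\,\partial_y f_{Y|X}(y|x)|\le\overline C$ and $|\partial_x F_{Y|X}(y|x)+y\,\partial_x f_{Y|X}(y|x)|\le\overline C$ a.e. (vi)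 $\underline C\le f_X\le\overline C'$ on $[0,1]$.
   Formalization: Proved for the class of all distributions satisfying (i)–(vi) rather than any class (a singleton class has zero regret), and with the upper bound constants C̄ > 2, C̄' ≥ 1 and lower density bound C̲ ≤ 1; otherwise that class is empty or the regret is 0. *)

(* Defs.v *)
From HB Require Import structures.
From mathcomp Require Import all_boot all_order all_algebra.
From mathcomp Require Import all_classical all_reals all_analysis.
Import Order.TTheory GRing.Theory Num.Theory.
Import numFieldNormedType.Exports.

Set Implicit Arguments.
Unset Strict Implicit.
Unset Printing Implicit Defensive.

Local Open Scope classical_set_scope.
Local Open Scope ring_scope.

(* Pairs are ordered (y, x): valuation, then covariate; a conditional        *)
(* density is written f y x for f(y|x). Functions of y and x are total on R, *)
(* but only their values on [0, 1]^2 are ever constrained.                   *)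

Section iid_sample.
Context d (T : measurableType d) (R : realType) (P : probability T R).

Definition cons_tuple n (z : T * n.-tuple T) : n.+1.-tuple T :=
  [tuple of z.1 :: z.2].

Lemma measurable_cons_tuple n :
  measurable_fun [set: T * n.-tuple T] (@cons_tuple n).
Proof. exact: measurable_cons. Qed.

HB.instance Definition _ n :=
  isMeasurableFun.Build _ _ _ _ (@cons_tuple n) (@measurable_cons_tuple n).

(* The n-fold product measure: the law of n i.i.d. draws from P.             *)
Fixpoint iid_law n : probability (n.-tuple T) R :=
  match n with
  | 0%N => \d_([tuple] : 0.-tuple T)
  | n'.+1 => distribution (P \x iid_law n')%E (@cons_tuple n')
  end.

End iid_sample.

Section partial_derivatives.
Context {R : realType}.
Implicit Type f : R -> R -> R.

Definition derivable_y f y x : Prop := derivable (f ^~ x) y 1.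
Definition derivable_x f y x : Prop := derivable (f y) x 1.
Definition d_y f y x : R := derive1 (f ^~ x) y.
Definition d_x f y x : R := derive1 (f y) x.

Definition C1_on (U : set (R * R)) f : Prop :=
  (forall z, U z -> derivable_y f z.1 z.2 /\ derivable_x f z.1 z.2) /\
  (forall z, U z -> {for z, continuous (fun w : R * R => d_y f w.1 w.2)}
                 /\ {for z, continuous (fun w : R * R => d_x f w.1 w.2)}).

End partial_derivatives.

Definition unit_itv {R : realType} : set R := `[0, 1]%classic.

Definition unit_square {R : realType} : set (R * R) :=
  unit_itv `*` unit_itv.

Notation leb2 := (lebesgue_measure \x lebesgue_measure)%E.

Section strict_concavity.
Context {R : realType}.

Definition strictly_concave_on01 (g : R -> R) : Prop :=
  forall a b t : R, a \in `[0, 1] -> b \in `[0, 1] -> a != b -> t \in `]0, 1[ ->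
    t * g a + (1 - t) * g b < g (t * a + (1 - t) * b).

End strict_concavity.

(* A joint distribution of (Y, X) on [0, 1]^2 given together with its        *)
(* marginal density of X and its conditional density of Y given X. That fX   *)
(* integrates to 1 follows from joint_lawE at setT and fYX_int1.             *)
Record joint_distr (R : realType) := JointDistr {
  joint_law : probability (R * R)%type R ;
  fX : R -> R ;
  fYX : R -> R -> R ;
  measurable_fX : measurable_fun unit_itv fX ;
  fX_ge0 : forall x, x \in `[0, 1] -> 0 <= fX x ;
  measurable_fYX :
    measurable_fun unit_square (fun z : R * R => fYX z.1 z.2) ;
  fYX_ge0 : forall y x, y \in `[0, 1] -> x \in `[0, 1] -> 0 <= fYX y x ;
  fYX_int1 : forall x, x \in `[0, 1] ->
    (\int[lebesgue_measure]_(y in unit_itv) (fYX y x)%:E = 1)%E ;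
  joint_lawE : forall A : set (R * R), measurable A ->
    (joint_law A =
     \int[leb2]_(z in A `&` unit_square) (fYX z.1 z.2 * fX z.2)%:E)%E
}.

Section pricing.
Context {R : realType}.
Implicit Types (F : joint_distr R) (p : R -> R).

Definition cond_cdf F (y x : R) : R :=
  \int[lebesgue_measure]_(t in `[0, y]) fYX F t x.

Definition revenue F (y x : R) : R := y * (1 - cond_cdf F y x).

Definition is_pricing p : Prop :=
  measurable_fun unit_itv p /\ (forall x, x \in `[0, 1] -> p x \in `[0, 1]).

Definition expected_revenue p F : R :=
  \int[lebesgue_measure]_(x in unit_itv) (revenue F (p x) x * fX F x).

(* A maximizer of revenue F ^~ x over [0, 1]; it is unique as soon as        *)
(* revenue F ^~ x is strictly concave, so that choice plays no role then.    *)
Definition opt_price F (x : R) : R :=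
  xget 0 [set y | y \in `[0, 1] /\
                  forall y', y' \in `[0, 1] -> revenue F y' x <= revenue F y x].

(* "a.e." is with respect to Lebesgue measure on [0, 1]^2; the derivatives   *)
(* are required to exist a.e. since derive1 is a junk value otherwise. In    *)
(* reg_smooth, the density is only meaningful on [0, 1]^2 and the curve      *)
(* reaches x = 0 and x = 1: continuous differentiability on the relative     *)
(* neighborhood is that of a function g on an open set U of the plane.       *)
Record regular (C0 Cbar Cbar' Cunder Cstar : R) F : Prop := Regular {
  reg_lipschitz : forall y y' x,
    y \in `[0, 1] -> y' \in `[0, 1] -> x \in `[0, 1] ->
    `|fYX F y x - fYX F y' x| <= C0 * `|y - y'| ;
  reg_concave : forall x, x \in `[0, 1] ->
    strictly_concave_on01 (revenue F ^~ x) ;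
  reg_curvature : {ae leb2, forall z : R * R, unit_square z ->
    derivable_y (fYX F) z.1 z.2 /\
    - 2 * fYX F z.1 z.2 - z.1 * d_y (fYX F) z.1 z.2 <= - Cstar} ;
  reg_interior : forall x, x \in `[0, 1] -> opt_price F x \in `]0, 1[ ;
  reg_smooth : exists (U : set (R * R)) (g : R -> R -> R),
    [/\ open U,
        (forall x, x \in `[0, 1] -> U (opt_price F x, x)),
        C1_on U g &
        forall z, U z -> unit_square z -> fYX F z.1 z.2 = g z.1 z.2] ;
  reg_bound_y : {ae leb2, forall z : R * R, unit_square z ->
    derivable_y (fYX F) z.1 z.2 /\
    `|2 * fYX F z.1 z.2 + z.1 * d_y (fYX F) z.1 z.2| <= Cbar} ;
  reg_bound_x : {ae leb2, forall z : R * R, unit_square z ->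
    [/\ derivable_x (cond_cdf F) z.1 z.2,
        derivable_x (fYX F) z.1 z.2 &
        `|d_x (cond_cdf F) z.1 z.2 + z.1 * d_x (fYX F) z.1 z.2| <= Cbar]} ;
  reg_fX : forall x, x \in `[0, 1] -> Cunder <= fX F x <= Cbar'
}.

(* A data-based pricing strategy for a class of distributions: besides being *)
(* a pricing function for every sample, its realized revenue is a random     *)
(* variable under each distribution of the class, i.e. its expectation over  *)
(* the sample is meaningful. No joint measurability is imposed.              *)
Definition is_strategy (cls : set (joint_distr R)) n
    (p : n.-tuple (R * R) -> R -> R) : Prop :=
  (forall data, is_pricing (p data)) /\
  (forall F, cls F ->
     measurable_fun [set: n.-tuple (R * R)]
       (fun data => expected_revenue (p data) F)).

Definition regret n (p : n.-tuple (R * R) -> R -> R) F : \bar R :=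
  ((expected_revenue (opt_price F) F)%:E -
   'E_(iid_law (joint_law F) n)[fun data => expected_revenue (p data) F])%E.

Definition minimax_regret (cls : set (joint_distr R)) n : \bar R :=
  ereal_inf [set ereal_sup [set regret p F | F in cls] |
                p in [set p | @is_strategy cls n p]].

End pricing.

(* Main.v *)
(* Perturb the uniform distribution on [0, 1]^2, whose optimal price is 1/2    *)
(* everywhere. Cut [0, 1] into m cells and, on the cell j, add to the          *)
(* conditional density a smooth signed bump of size k/m in y and x, localized  *)
(* at distance 1/m of y = 1/2 and of the centre of the cell, with sign w j.    *)
(* The slopes stay bounded, so that for k small every sign vector w gives a    *)
(* regular distribution. Changing the sign w j moves the optimal price on the  *)
(* cell j by an amount of order 1/m, so that no price is good for both signs:  *)
(* the two losses at x add up to at least a constant times 1/m^2. On the other *)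
(* hand the two distributions have squared Hellinger distance of order         *)
(* (1/m)^2 (the squared size) times (1/m)^2 (the area), hence n draws do not   *)
(* distinguish them as long as n <= m^4. Averaging over all w (Assouad) yields *)
(* a regret of order 1/m^2, that is n^(-1/2) for m of order n^(1/4).           *)

Require Import Defs.
From mathcomp Require Import all_boot all_order all_algebra.
From mathcomp Require Import all_classical all_reals all_analysis.
From mathcomp Require Import measurable_realfun ring lra.
From HB Require Import structures.
Import Order.TTheory GRing.Theory Num.Theory.
Import numFieldNormedType.Exports.
Local Open Scope classical_set_scope.
Local Open Scope ring_scope.

Set Implicit Arguments.
Unset Strict Implicit.
Unset Printing Implicit Defensive.

(** * Derivatives and bump functions *)

(** For each pricing rule it is enough to exhibit one regular distribution on which it does badly.
    The candidates [cube_distr] are indexed by sign vectors [w], one sign per cell, and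
    [pert_regular] places all of them in the class, with an amplitude [k] that does not depend on
    the number m of cells.

    Two facts are played against each other. On the middle half of cell j, no price suits both [w]
    and [flip j w]: the two losses add up to at least k^2 / (128 m^2) ([two_point_gain],
    [cube_loss_pair]). Yet the sample hardly tells these two distributions apart: their one-draw
    affinity is 1 - O(m^-4), affinities of independent draws multiply, and hence for n <= m^4 the
    minimum of the two likelihoods still integrates to at least 1/4 ([integral_min_likelihood]).

    [cube_weighted_loss] combines the pairwise losses for one fixed sample, with the likelihoods as
    weights. Integrating it over the sample, under the uniform law as common reference, gives
    [cube_regret_lower]: the regret averaged over all sign vectors, hence the regret at some [w], is
    at least k^2 / (2048 m^2). The choice of m of order n^(1/4) in [fourth_root_ceil] turns this
    into n^(-1/2). *)

Section derivatives.
Context {R : realType}.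
Implicit Types (f g : R -> R) (x y s t a b df dg : R).

Lemma is_derive1_mul f g x df dg :
  is_derive x 1 f df -> is_derive x 1 g dg ->
  is_derive x 1 (fun t => f t * g t) (f x * dg + g x * df).
Proof.
move=> hf hg; rewrite -[X in is_derive _ _ X _]/(f * g).
exact: is_deriveM.
Qed.

Lemma is_derive1_add f g x df dg :
  is_derive x 1 f df -> is_derive x 1 g dg ->
  is_derive x 1 (fun t => f t + g t) (df + dg).
Proof. by move=> hf hg; exact: is_deriveD. Qed.

Lemma is_derive1_sum (I : Type) (s : seq I) (F : I -> R -> R) (dF : I -> R) x :
  (forall i, is_derive x 1 (F i) (dF i)) ->
  is_derive x 1 (fun t => \sum_(i <- s) F i t) (\sum_(i <- s) dF i).
Proof.
move=> hF; elim: s => [|i s IH].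
  rewrite big_nil; under eq_fun do rewrite big_nil; exact: is_derive_cst.
rewrite big_cons; under eq_fun do rewrite big_cons; exact: is_derive1_add.
Qed.

Lemma is_derive1_scale a f x df :
  is_derive x 1 f df -> is_derive x 1 (fun t => a * f t) (a * df).
Proof. by move=> hf; exact: is_deriveZ. Qed.

Lemma is_derive1_affine a b x : is_derive x 1 (fun t => a * t + b) a.
Proof.
rewrite -[X in is_derive _ _ _ X]addr0; apply: is_derive1_add.
by rewrite -[X in is_derive _ _ _ X]mulr1; apply: is_derive1_scale; exact: is_derive_id.
Qed.

Lemma is_derive1_comp_affine f a b x df :
  is_derive (a * x + b) 1 f df -> is_derive x 1 (fun t => f (a * t + b)) (a * df).
Proof.
move=> hf; rewrite mulrC.
exact: (is_derive1_comp (f := f) (g := fun t => a * t + b)) hf (is_derive1_affine a b x).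
Qed.

Lemma is_derive1_continuous f x df : is_derive x 1 f df -> {for x, continuous f}.
Proof.
move=> [dfx _]; apply: differentiable_continuous.
exact/derivable1_diffP.
Qed.

Lemma lipschitz_is_derive1 f (df : R -> R) (L : R) x y :
  (forall t : R, is_derive t 1 f (df t)) -> (forall t, `|df t| <= L) ->
  `|f x - f y| <= L * `|x - y|.
Proof.
move=> hf bf; wlog yx : x y / y <= x.
  move=> H; have [/H//|/ltW/H] := leP y x.
  by rewrite distrC [in X in _ <= X]distrC.
have hf' t : t \in `]y, x[ -> is_derive t 1 f (df t) by move=> _; exact: hf.
have cf : {within `[y, x], continuous f}.
  by apply: continuous_subspaceT => t; exact: is_derive1_continuous (hf t).
have [c _ ->] := MVT_segment yx hf' cf.
by rewrite normrM ler_wpM2r.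
Qed.

(** The mean value theorem on both sides of the intermediate point c gives slopes at some p < c < q;
    that the slope at q is smaller than the one at p is the strict inequality sought at c. *)
Lemma strictly_concave_is_derive1 f (df : R -> R) :
  (forall t : R, t \in `[0, 1] -> is_derive t 1 f (df t)) ->
  (forall s t, s \in `[0, 1] -> t \in `[0, 1] -> s < t -> df t < df s) ->
  strictly_concave_on01 f.
Proof.
move=> hf ddf.
have key a b t : a \in `[0, 1] -> b \in `[0, 1] -> a < b -> t \in `]0, 1[ ->
    t * f a + (1 - t) * f b < f (t * a + (1 - t) * b).
  rewrite !in_itv/= => /andP[a0 a1] /andP[b0 b1] ab /andP[t0 t1].
  set c := t * a + (1 - t) * b.
  have ac : a < c by rewrite /c; nra.
  have cb : c < b by rewrite /c; nra.
  have inab s : a <= s <= b -> s \in `[0, 1].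
    by rewrite in_itv/= => /andP[? ?]; lra.
  have contf u v : a <= u -> v <= b -> {within `[u, v], continuous f}.
    move=> au vb; apply: continuous_in_subspaceT => s.
    rewrite inE/= in_itv/= => /andP[us sv].
    by apply: is_derive1_continuous (hf _ _); apply: inab; lra.
  have hf' u v s : a <= u -> v <= b -> s \in `]u, v[ -> is_derive s 1 f (df s).
    by move=> au vb; rewrite in_itv/= => /andP[? ?]; apply/hf/inab; lra.
  have [p] := MVT ac (fun s => hf' a c s (lexx a) (ltW cb)) (contf a c (lexx a) (ltW cb)).
  rewrite in_itv/= => /andP[ap pc] fac.
  have [q] := MVT cb (fun s => hf' c b s (ltW ac) (lexx b)) (contf c b (ltW ac) (lexx b)).
  rewrite in_itv/= => /andP[cq qb] fcb.
  have dqp : df q < df p by apply: ddf; [apply: inab; lra|apply: inab; lra|lra].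
  have ca : c - a = (1 - t) * (b - a) by rewrite /c; ring.
  have bc : b - c = t * (b - a) by rewrite /c; ring.
  have -> : f a = f c - df p * ((1 - t) * (b - a)) by rewrite -ca -fac; ring.
  have -> : f b = f c + df q * (t * (b - a)) by rewrite -bc -fcb; ring.
  have pos : 0 < t * (1 - t) * (b - a) by rewrite !mulr_gt0// subr_gt0.
  suff : 0 < (t * (1 - t) * (b - a)) * (df p - df q) by lra.
  by rewrite mulr_gt0// subr_gt0.
move=> a b t ha hb ab ht; case: (ltgtP a b) => [ltab|ltba|eab].
- exact: key.
- have ht' : 1 - t \in `]0, 1[ by move: ht; rewrite !in_itv/= => /andP[? ?]; lra.
  have := key b a (1 - t) hb ha ltba ht'.
  by rewrite (_ : 1 - (1 - t) = t) 1?addrC 1?[in X in _ < f X]addrC; [|lra].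
- by rewrite eab eqxx in ab.
Qed.

Lemma is_derive1_max0_sqr x :
  is_derive x 1 (fun t => Num.max 0 t ^+ 2) (2 * Num.max 0 x).
Proof.
have [x0|x0|->] := ltgtP x 0.
- rewrite mulr0.
  apply: (near_eq_is_derive (f := cst 0)).
  near=> t; rewrite max_l ?expr0n//= ltW//.
  by near: t; exact: lt_nbhsl.
- apply: (near_eq_is_derive (f := fun t => t * t)).
    near=> t; rewrite max_r ?expr2//= ltW//.
    by near: t; exact: lt_nbhsr.
  have := is_derive1_mul (is_derive_id x 1) (is_derive_id x 1).
  by rewrite /= !mulr1 -mulr2n mulr_natl.
(* At 0 the difference quotient of the squared positive part is the positive part itself, which is
   continuous and vanishes there. *)
- apply/is_derive1_caratheodory; exists (fun z => Num.max 0 z); split.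
  + move=> z; rewrite maxxx expr0n/= !subr0.
    by rewrite expr2; case: (leP 0 z) => [|/ltW] z0; rewrite ?mul0r ?mulr0.
  + by apply: continuous_max; [exact: cst_continuous|exact: cvg_id].
  + by rewrite mulr0 maxxx.
Unshelve. all: by end_near. Qed.

End derivatives.

(** * Compactly supported bumps and their bounds *)

Section bumps.
Context {R : realType}.
Implicit Types u : R.

Definition cap u : R := Num.max 0 (1 - u ^+ 2).
Definition bump u : R := cap u ^+ 2.
Definition dbump u : R := - 4 * u * cap u.
(** On (-1, 1) this is u (1 - u^2)^3, the primitive of the perturbation [dwave] of the density. It
    vanishes outside (-1, 1), so that perturbation has total mass zero. The squared cap in [bump]
    makes [wave] of class C2, which a C1 conditional density requires. *)
Definition wave u : R := u * (1 - u ^+ 2) * bump u.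
Definition dwave u : R := (1 - 7 * u ^+ 2) * bump u.
Definition ddwave u : R := (1 - 7 * u ^+ 2) * dbump u - 14 * u * bump u.

Lemma capP u : cap u = 0 /\ 1 <= `|u| \/ cap u = 1 - u ^+ 2 /\ `|u| < 1.
Proof.
rewrite /cap; case: (ltP `|u| 1) => u1; [right|left]; split => //.
  by rewrite max_r// subr_ge0 -(real_normK (num_real u)) expr_le1// ltW.
by rewrite max_l// subr_le0 -(real_normK (num_real u)) expr_ge1.
Qed.

Lemma bump0 u : 1 <= `|u| -> bump u = 0.
Proof.
rewrite /bump; case: (capP u) => [[-> _]|[_ u1]]; first by rewrite expr0n.
by rewrite leNgt u1.
Qed.

Lemma dbump0 u : 1 <= `|u| -> dbump u = 0.
Proof.
rewrite /dbump; case: (capP u) => [[-> _]|[_ u1]]; first by rewrite mulr0.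
by rewrite leNgt u1.
Qed.

Lemma bump_ge0 u : 0 <= bump u. Proof. exact: sqr_ge0. Qed.

Lemma bump_le1 u : bump u <= 1.
Proof.
rewrite /bump; case: (capP u) => [[-> _]|[-> /ltr_normlP[u1 u2]]].
  by rewrite expr0n/= ler01.
by apply: exprn_ile1 => //; nra.
Qed.

Lemma bump_half u : `|u| <= 1/2 -> 1/2 <= bump u.
Proof.
rewrite /bump => u2; case: (capP u) => [[_ u1]|[-> _]]; first lra.
have /ler_normlP[h1 h2] := u2.
have : u ^+ 2 <= 1/4 by nra.
nra.
Qed.

Lemma dbump_bound u : `|dbump u| <= 4.
Proof.
rewrite /dbump; case: (capP u) => [[-> _]|[-> /ltr_normlP[u1 u2]]].
  by rewrite mulr0 normr0.
have h : 0 <= 1 - u ^+ 2 <= 1 by apply/andP; split; nra.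
by rewrite ler_norml; apply/andP; split; nra.
Qed.

Lemma wave_bound u : `|wave u| <= 1.
Proof.
rewrite /wave /bump; case: (capP u) => [[-> _]|[-> u1]].
  by rewrite expr0n/= mulr0 normr0.
rewrite !normrM -mulrA; have /ltr_normlP[? ?] := u1.
have h : `|1 - u ^+ 2| <= 1 by rewrite ler_norml; apply/andP; split; nra.
by rewrite !mulr_ile1 ?mulr_ge0 ?normrX ?exprn_ile1 // ltW.
Qed.

Lemma dwave_bound u : `|dwave u| <= 6.
Proof.
rewrite /dwave normrM; case: (ltP `|u| 1) => [u1|/bump0 ->]; last first.
  by rewrite normr0 mulr0.
have /ltr_normlP[? ?] := u1.
have h : `|1 - 7 * u ^+ 2| <= 6 by rewrite ler_norml; apply/andP; split; nra.
rewrite (ger0_norm (bump_ge0 u)); have := bump_ge0 u; have := bump_le1 u.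
have := normr_ge0 (1 - 7 * u ^+ 2); nra.
Qed.

Lemma ddwave_bound u : `|ddwave u| <= 42.
Proof.
rewrite /ddwave; case: (ltP `|u| 1) => [u1|u1]; last first.
  by rewrite bump0// dbump0// !mulr0 subr0 normr0.
have /ltr_normlP[? ?] := u1.
have h : `|1 - 7 * u ^+ 2| <= 6 by rewrite ler_norml; apply/andP; split; nra.
apply: (le_trans (ler_normB _ _)); rewrite normrM (normrM (14 * u)) (normrM 14) (ger0_norm (bump_ge0 u)).
have := bump_ge0 u; have := bump_le1 u; have := dbump_bound u.
have -> : `|14 : R| = 14 by rewrite ger0_norm.
have := normr_ge0 (1 - 7 * u ^+ 2); have := normr_ge0 (dbump u).
have := normr_ge0 u; nra.
Qed.

Lemma wave0 u : 1 <= `|u| -> wave u = 0.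
Proof. by move=> u1; rewrite /wave bump0// mulr0. Qed.

Lemma dwave0 u : 1 <= `|u| -> dwave u = 0.
Proof. by move=> u1; rewrite /dwave bump0// mulr0. Qed.

Lemma capN u : cap (- u) = cap u. Proof. by rewrite /cap sqrrN. Qed.

Lemma waveN u : wave (- u) = - wave u.
Proof. by rewrite /wave /bump capN sqrrN; ring. Qed.

(** Near the origin the factor (1 - u^2)^3 stays above 1/2. This quantifies the first-order gain
    from moving the price off 1/2. *)
Lemma wave_lower u : `|u| <= 1/10 -> u ^+ 2 / 2 <= u * wave u.
Proof.
move=> u10; rewrite /wave /bump; case: (capP u) => [[_ u1]|[-> _]]; first lra.
have /ler_normlP[h1 h2] := u10.
have hu : 0 <= u ^+ 2 by exact: sqr_ge0.
have {}h : u ^+ 2 <= 1/100 by nra.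
rewrite (_ : u * _ = u ^+ 2 * (1 - u ^+ 2) ^+ 3); last by ring.
rewrite ler_wpM2l//; move: hu h; set v := u ^+ 2 => hu h.
have : 9/10 <= 1 - v by lra.
set w := 1 - v => hw; have : 81/100 <= w ^+ 2 by nra.
by rewrite exprS; nra.
Qed.

Lemma is_derive_bump u : is_derive u 1 bump (dbump u).
Proof.
have hs : is_derive u 1 (fun t : R => 1 - t ^+ 2) (- (2 * u)).
  have -> : (fun t : R => 1 - t ^+ 2) = (fun t => 1 + (-1) * (t * t)).
    by apply/funext => t; ring.
  have := is_derive1_add (is_derive_cst (1 : R) u 1)
    (is_derive1_scale (-1) (is_derive1_mul (is_derive_id u 1) (is_derive_id u 1))).
  by congr is_derive; rewrite /=; ring.
rewrite (_ : dbump u = 2 * cap u * - (2 * u)); last by rewrite /dbump; ring.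
exact: (is_derive1_comp (f := fun t => Num.max 0 t ^+ 2)
  (g := fun t => 1 - t ^+ 2)) (is_derive1_max0_sqr (1 - u ^+ 2)) hs.
Qed.

Lemma is_derive_dwave u : is_derive u 1 dwave (ddwave u).
Proof.
have hs : is_derive u 1 (fun t : R => 1 - 7 * t ^+ 2) (- 14 * u).
  have -> : (fun t : R => 1 - 7 * t ^+ 2) = (fun t => 1 + (-7) * (t * t)).
    by apply/funext => t; ring.
  have := is_derive1_add (is_derive_cst (1 : R) u 1)
    (is_derive1_scale (-7) (is_derive1_mul (is_derive_id u 1) (is_derive_id u 1))).
  by congr is_derive; rewrite /=; ring.
have := is_derive1_mul hs (is_derive_bump u).
by congr is_derive; rewrite /ddwave; ring.
Qed.

Lemma is_derive_wave u : is_derive u 1 wave (dwave u).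
Proof.
have hs : is_derive u 1 (fun t : R => t * (1 - t ^+ 2)) (1 - 3 * u ^+ 2).
  have -> : (fun t : R => t * (1 - t ^+ 2)) = (fun t => t + (-1) * (t * (t * t))).
    by apply/funext => t; ring.
  have := is_derive1_add (is_derive_id u 1) (is_derive1_scale (-1)
    (is_derive1_mul (is_derive_id u 1)
      (is_derive1_mul (is_derive_id u 1) (is_derive_id u 1)))).
  by congr is_derive; rewrite /=; ring.
have := is_derive1_mul hs (is_derive_bump u); congr is_derive.
(* [dbump] brings a single factor [cap u]; the factor 1 - u^2 of [wave] turns it into its square, in
   both cases of [capP]. *)
rewrite /dwave /dbump /bump; case: (capP u) => -[-> _]; ring.
Qed.

Lemma continuous_cap : continuous cap.
Proof.
move=> u; apply: (@continuous_max _ _ (cst 0) (fun u => 1 - u ^+ 2) u).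
  exact: cst_continuous.
by apply: cvgB; [exact: cvg_cst|exact: exprn_continuous].
Qed.

Lemma continuous_bump : continuous bump.
Proof. by move=> u; exact: is_derive1_continuous (is_derive_bump u). Qed.

Lemma continuous_wave : continuous wave.
Proof. by move=> u; exact: is_derive1_continuous (is_derive_wave u). Qed.

Lemma continuous_dwave : continuous dwave.
Proof. by move=> u; exact: is_derive1_continuous (is_derive_dwave u). Qed.

Lemma continuous_dbump : continuous dbump.
Proof.
move=> u; apply: cvgM; last exact: continuous_cap.
by apply: cvgM; [exact: cvg_cst|exact: cvg_id].
Qed.

Lemma continuous_ddwave : continuous ddwave.
Proof.
move=> u; apply: cvgB; apply: cvgM.
- apply: cvgB; first exact: cvg_cst.
  by apply: cvgM; [exact: cvg_cst|exact: exprn_continuous].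
- exact: continuous_dbump.
- by apply: cvgM; [exact: cvg_cst|exact: cvg_id].
- exact: continuous_bump.
Qed.

End bumps.

(** * Densities and samples *)

Section change_of_density.
Import HBNNSimple.

(** Standard approximation: indicators, then simple functions by linearity, then [f] by monotone
    convergence. *)
Lemma ge0_integral_density d (T : measurableType d) (R : realType)
    (mu nu : {measure set T -> \bar R}) (g : T -> R) (f : T -> \bar R) :
  measurable_fun setT g -> (forall x, 0 <= g x) ->
  (forall A, measurable A -> nu A = \int[mu]_(x in A) (g x)%:E)%E ->
  measurable_fun setT f -> (forall x, 0 <= f x)%E ->
  (\int[nu]_x f x = \int[mu]_x (f x * (g x)%:E))%E.
Proof.
move=> mg g0 nuE mf f0.
have mfg (h : {nnsfun T >-> R}) : measurable_fun setT (fun x => (h x)%:E * (g x)%:E)%E.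
  by apply: emeasurable_funM; apply/measurable_EFinP => //; exact: measurable_funPT.
have nnsE (h : {nnsfun T >-> R}) :
    (\int[nu]_x (h x)%:E = \int[mu]_x ((h x)%:E * (g x)%:E))%E.
  under eq_integral do rewrite fimfunE -fsumEFin//.
  rewrite [LHS]ge0_integral_fsum//; last 2 first.
    - by move=> r; exact/measurable_EFinP/measurableT_comp.
    - by move=> n x _; rewrite EFinM nnfun_muleindic_ge0.
  under [RHS]eq_integral.
    move=> x xD; rewrite fimfunE -fsumEFin// muleC ge0_mule_fsumr; last first.
      by move=> r; rewrite EFinM nnfun_muleindic_ge0.
    over.
  rewrite [RHS]ge0_integral_fsum//; last 2 first.
    - move=> r; apply: emeasurable_funM; apply/measurable_EFinP => //.
      by apply/measurableT_comp => //.
    - move=> n x _; apply: mule_ge0; first by rewrite lee_fin.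
      by rewrite EFinM nnfun_muleindic_ge0.
  apply: eq_fsbigr => r _.
  rewrite integralZl_indic_nnsfun//= integral_indic// setIT nuE//.
  under [RHS]eq_integral do rewrite EFinM muleCA.
  have [r0|r0] := ltP r 0.
    rewrite preimage_nnfun0// integral_set0 mule0 integral0_eq// => x _.
    by rewrite indicE in_set0 mule0 mule0.
  rewrite ge0_integralZl//.
  - rewrite integral_mkcond; congr (_ * _)%E; apply: eq_integral => x _.
    by rewrite patchE indicE; case: ifP; rewrite ?mule1 ?mule0.
  - apply: emeasurable_funM; apply/measurable_EFinP => //.
  - by move=> x _; rewrite mule_ge0 ?lee_fin.
pose f_ := nnsfun_approx measurableT mf.
have cf x : (EFin \o f_^~ x) n @[n --> \oo] --> f x.
  by apply: cvg_nnsfun_approx.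
transitivity (lim (\int[nu]_x (f_ n x)%:E @[n --> \oo])%E).
  rewrite -monotone_convergence//=.
  - apply: eq_integral => x _; apply/esym/cvg_lim => //=; exact: cf.
  - by move=> n; exact/measurable_EFinP/measurable_funTS.
  - by move=> n ? _; rewrite lee_fin.
  - by move=> ? _ ? ? mn; rewrite lee_fin; exact/lefP/nd_nnsfun_approx.
under eq_fun do rewrite nnsE.
rewrite -monotone_convergence//=.
- apply: eq_integral => x _; apply/cvg_lim => //=.
  by apply: cvgeZr => //; exact: cf.
- by move=> n x _; rewrite mule_ge0 ?lee_fin.
- move=> x _ ? ? mn; rewrite lee_wpmul2r ?lee_fin//.
  exact/lefP/nd_nnsfun_approx.
Qed.

End change_of_density.

Section iid_density.
Context d (T : measurableType d) (R : realType) (P : probability T R).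

Lemma ge0_integral_iid_lawS n (G : n.+1.-tuple T -> \bar R) :
  measurable_fun setT G -> (forall t, 0 <= G t)%E ->
  (\int[iid_law P n.+1]_t G t =
   \int[P]_x \int[iid_law P n]_t G (Defs.cons_tuple (x, t)))%E.
Proof.
move=> mG G0 /=; rewrite ge0_integral_distribution//.
rewrite fubini_tonelli1//.
  by apply: measurableT_comp => //; exact: measurable_cons_tuple.
by move=> z; exact: G0.
Qed.

Lemma measurable_prod_tnth n (g : T -> R) : measurable_fun setT g ->
  measurable_fun setT (fun t : n.-tuple T => \prod_(i < n) g (tnth t i)).
Proof.
move=> mg; apply: measurable_prod => i _.
by apply: measurableT_comp => //; exact: measurable_tnth.
Qed.

Lemma prod_tnth_cons n (g : T -> R) x (t : n.-tuple T) :
  \prod_(i < n.+1) g (tnth (Defs.cons_tuple (x, t)) i) =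
  g x * \prod_(i < n) g (tnth t i).
Proof.
rewrite big_ord_recl; congr (g _ * _); apply: eq_bigr => i _.
by rewrite !(tnth_nth x).
Qed.

(** Independence of the draws. It serves twice: for the total mass of the likelihood and for the
    affinity of n draws. *)
Lemma integral_iid_prod n (h : T -> R) : measurable_fun setT h ->
  (forall x, 0 <= h x) ->
  (\int[iid_law P n]_t (\prod_(i < n) h (tnth t i))%:E =
   (\int[P]_x (h x)%:E) ^+ n)%E.
Proof.
move=> mh h0; elim: n => [|n IH].
  under eq_integral do rewrite big_ord0.
  by rewrite integral_cst// mul1e expe0; exact: (probability_setT (iid_law P 0)).
have Q0 m (t : m.-tuple T) : 0 <= \prod_(i < m) h (tnth t i) by apply: prodr_ge0.
rewrite ge0_integral_iid_lawS//; last 2 first.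
- by apply/measurable_EFinP; exact: measurable_prod_tnth.
- by move=> t; rewrite lee_fin.
transitivity (\int[P]_x ((h x)%:E * (\int[P]_x (h x)%:E) ^+ n))%E.
  apply: eq_integral => x _; rewrite -IH -ge0_integralZl//.
  + by apply: eq_integral => t _; rewrite prod_tnth_cons EFinM.
  + by apply/measurable_EFinP; exact: measurable_prod_tnth.
  + by move=> t _; rewrite lee_fin.
  + by rewrite lee_fin.
rewrite ge0_integralZr ?expeS//.
- exact/measurable_EFinP.
- by move=> x _; rewrite lee_fin.
- by apply: expe_ge0; apply: integral_ge0 => x _; rewrite lee_fin.
Qed.

End iid_density.

(** Induction on the sample size: Tonelli isolates the first draw, whose law is changed by
    [ge0_integral_density]. All sample laws of the cube thereby become likelihood weights under one
    reference law. *)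
Lemma ge0_integral_iid_density d (T : measurableType d) (R : realType)
    (P mu : probability T R) n (g : T -> R) (G : n.-tuple T -> \bar R) :
  measurable_fun setT g -> (forall x, 0 <= g x) ->
  (forall A, measurable A -> P A = \int[mu]_(x in A) (g x)%:E)%E ->
  measurable_fun setT G -> (forall t, 0 <= G t)%E ->
  (\int[iid_law P n]_t G t =
   \int[iid_law mu n]_t (G t * (\prod_(i < n) g (tnth t i))%:E))%E.
Proof.
move=> mg g0 Pg; elim: n G => [|n IH] G mG G0.
  by apply: eq_integral => t _; rewrite big_ord0 mule1.
have mQ := @measurable_prod_tnth _ _ _ n.+1 _ mg.
have Q0 m (t : m.-tuple T) : 0 <= \prod_(i < m) g (tnth t i) by apply: prodr_ge0.
have mGQ : measurable_fun setT
    (fun t : n.+1.-tuple T => G t * (\prod_(i < n.+1) g (tnth t i))%:E)%E.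
  by apply: emeasurable_funM => //; exact/measurable_EFinP.
have GQ0 t : (0 <= G t * (\prod_(i < n.+1) g (tnth t i))%:E)%E.
  by rewrite mule_ge0 ?lee_fin.
have mc (H : n.+1.-tuple T -> \bar R) x : measurable_fun setT H ->
    measurable_fun setT (fun t : n.-tuple T => H (Defs.cons_tuple (x, t))).
  move=> mH; apply: measurableT_comp => //.
  apply: (measurableT_comp (@measurable_cons_tuple _ T n)).
  exact: measurable_pair1.
rewrite ge0_integral_iid_lawS// [RHS]ge0_integral_iid_lawS//.
rewrite (ge0_integral_density (g := g) (mu := mu))//.
- apply: eq_integral => x _.
  rewrite IH//; last exact: mc.
  rewrite muleC -ge0_integralZl//.
  + apply: eq_integral => t _.
    by rewrite prod_tnth_cons EFinM muleA [in RHS]muleA; congr (_ * _)%E; rewrite muleC.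
  + apply: emeasurable_funM; first exact: mc.
    by apply/measurable_EFinP; exact: measurable_prod_tnth.
  + by move=> t _; rewrite mule_ge0 ?lee_fin.
  + by rewrite lee_fin.
- have mGc : measurable_fun setT (fun z => G (@Defs.cons_tuple _ T n z)).
    by apply: measurableT_comp => //; exact: measurable_cons_tuple.
  have := @measurable_fun_fubini_tonelli_F _ _ _ _ _ (iid_law P n) _ mGc.
  by apply => z.
- by move=> x; apply: integral_ge0.
Qed.

Section density_probability.
Context d (T : measurableType d) (R : realType) (mu : probability T R).
Context (g : T -> R) (mg : measurable_fun setT g) (g0 : forall x, 0 <= g x)
  (g1 : (\int[mu]_x (g x)%:E = 1)%E).

(** The three proofs are arguments so that the probability structure can be inferred from the term
    itself. *)
Definition density_prob (_ : measurable_fun setT g) (_ : forall x, 0 <= g x)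
    (_ : (\int[mu]_x (g x)%:E = 1)%E) (A : set T) : \bar R :=
  (\int[mu]_(x in A) (g x)%:E)%E.

Local Notation P := (density_prob mg g0 g1).

Let P0 : P set0 = 0%E.
Proof. by rewrite /density_prob integral_set0. Qed.

Let P_ge0 A : (0 <= P A)%E.
Proof. by apply: integral_ge0 => x _; rewrite lee_fin. Qed.

Let P_sigma_additive : semi_sigma_additive P.
Proof.
move=> /= F mF tF mUF; rewrite /density_prob; apply: cvg_toP.
  apply: ereal_nondecreasing_is_cvgn => m n mn.
  apply: lee_sum_nneg_natr => // k _ _; exact: P_ge0.
rewrite ge0_integral_bigcup//=.
- by apply/measurable_EFinP; exact: measurable_funTS.
- by move=> x _; rewrite lee_fin.
Qed.

HB.instance Definition _ := isMeasure.Build _ _ _ P P0 P_ge0 P_sigma_additive.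

Let P_setT : P setT = 1%E. Proof. exact: g1. Qed.

HB.instance Definition _ := @Measure_isProbability.Build _ _ R P P_setT.

End density_probability.

(** * The uniform law on the square as reference measure *)

Section uniform_square.
Context {R : realType}.
Local Notation leb := (@lebesgue_measure R).

(* The two measurable structures on the reals, the canonical one and the one  *)
(* carrying the Lebesgue measure, have the same measurable sets but are not    *)
(* identified by unification, whence this coercion.                            *)
Definition to_real (x : measurableTypeR R) : R := x.

Let measurable_to_real : measurable_fun [set: measurableTypeR R] to_real.
Proof. by move=> _ Y mY; rewrite setTI. Qed.

HB.instance Definition _ :=
  isMeasurableFun.Build _ _ _ _ to_real measurable_to_real.

Definition unif01 : probability R R :=
  distribution (uniform_prob (@ltr01 R)) to_real.

Definition unif_square : probability (R * R)%type R := (unif01 \x unif01)%E.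

Lemma integral_unif01 (f : R -> \bar R) :
  measurable_fun setT f -> (forall x, 0 <= f x)%E ->
  (\int[unif01]_x f x = \int[leb]_(x in unit_itv) f x)%E.
Proof.
move=> mf f0; rewrite ge0_integral_distribution// integral_uniform//.
by rewrite subr0 invr1 mul1e.
Qed.

Lemma integral_unif_square (f : R * R -> \bar R) :
  measurable_fun setT f -> (forall z, 0 <= f z)%E ->
  (\int[unif_square]_z f z =
   \int[leb]_(x in unit_itv) \int[leb]_(y in unit_itv) f (y, x))%E.
Proof.
move=> mf f0; rewrite fubini_tonelli2//.
transitivity (\int[leb]_(x in unit_itv) fubini_G unif01 f x)%E.
  apply: integral_unif01.
  - exact: (measurable_fun_fubini_tonelli_G (m1 := unif01)).
  - by move=> x; apply: integral_ge0.
apply: eq_integral => x _; rewrite /fubini_G integral_unif01//.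
exact: measurableT_comp.
Qed.

Lemma integral_leb2_square (f : R * R -> \bar R) :
  measurable_fun setT f -> (forall z, 0 <= f z)%E ->
  (\int[leb \x leb]_(z in unit_square) f z =
   \int[leb]_(x in unit_itv) \int[leb]_(y in unit_itv) f (y, x))%E.
Proof.
move=> mf f0.
have mD : measurable (@unit_square R) by apply: measurableX; exact: measurable_itv.
have mfD : measurable_fun setT (f \_ unit_square).
  exact: (iffLR (measurable_restrictT f mD) (measurable_funTS mf)).
rewrite integral_mkcond fubini_tonelli2//.
- rewrite [RHS]integral_mkcond; apply: eq_integral => x _.
  rewrite patchE; case: ifPn => [|/negP] xI.
    rewrite [RHS]integral_mkcond; apply: eq_integral => y _.
    rewrite !patchE; congr (if _ then _ else _).
    by apply/idP/idP => /[!inE] => [[]//|yI]; split => //=; rewrite inE in xI.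
  rewrite /fubini_G integral0_eq// => y _; rewrite patchE; case: ifPn => //.
  by rewrite inE => -[_ /= /mem_set].
- by move=> z; rewrite patchE; case: ifP.
Qed.

(** Passes from densities with respect to the uniform law to the form required by the field
    [joint_lawE]. *)
Lemma integral_unif_squareE (A : set (R * R)) (f : R * R -> \bar R) :
  measurable A -> measurable_fun setT f -> (forall z, 0 <= f z)%E ->
  (\int[unif_square]_(z in A) f z = \int[leb \x leb]_(z in A `&` unit_square) f z)%E.
Proof.
move=> mA mf f0.
have mD : measurable (@unit_square R) by apply: measurableX; exact: measurable_itv.
have mfA : measurable_fun setT (f \_ A).
  exact: (iffLR (measurable_restrictT f mA) (measurable_funTS mf)).
have fA0 z : (0 <= (f \_ A) z)%E by rewrite patchE; case: ifP.
rewrite setIC integral_mkcondr [LHS]integral_mkcond.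
rewrite (integral_leb2_square mfA fA0).
exact: integral_unif_square.
Qed.

End uniform_square.

(** * Perturbations of the uniform distribution *)

Section perturbation_calculus.
Context {R : realType}.
Implicit Types (f g : R -> R) (x y : R).

Lemma derive1_is_derive f x (df : R) : is_derive x 1 f df -> derive1 f x = df.
Proof. by move=> hf; rewrite derive1E; exact: derive_val. Qed.

(** The factor of a perturbation that depends on x. The slope 8 M is that of a bump of height 1 on a
    cell of width 1 / M, namely 2 M times the bound 4 on [dbump]. *)
Record profile (M : R) (Phi dPhi : R -> R) : Prop := Profile {
  profile_derive : forall x, is_derive x 1 Phi (dPhi x) ;
  profile_dcont : continuous dPhi ;
  profile_bound : forall x, `|Phi x| <= 1 ;
  profile_dbound : forall x, `|dPhi x| <= 8 * M }.

(** The argument 2 M (y - 1/2) confines the perturbation to |y - 1/2| <= 1 / (2 M). The amplitude k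
    / M offsets the factor 2 M produced by differentiation, so that slopes in y are of order k
    uniformly in M. *)
Definition pert_dens (k M : R) (Phi : R -> R) y x : R :=
  1 + k / M * (Phi x * dwave (2 * M * y + - M)).

Definition pert_cdf (k M : R) (Phi : R -> R) y x : R :=
  y + k / (2 * M ^+ 2) * (Phi x * wave (2 * M * y + - M)).

(** The covariate enters only through the value v of the profile, which allows opposite signs to be
    compared at a fixed x. *)
Definition pert_revenue (k M v y : R) : R :=
  y * (1 - (y + k / (2 * M ^+ 2) * (v * wave (2 * M * y + - M)))).

Context (k M : R) (Phi dPhi : R -> R).
Hypotheses (hk : 0 <= k <= 1/100) (hM : 1 <= M) (hP : profile M Phi dPhi).

Local Notation dens := (pert_dens k M Phi).
Local Notation cdf := (pert_cdf k M Phi).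

Let Mgt0 : 0 < M. Proof. by move: hM; lra. Qed.
Let M0 : M != 0. Proof. exact: lt0r_neq0. Qed.
Let k0 : 0 <= k. Proof. by case/andP: hk. Qed.
Let kM0 : 0 <= k / M. Proof. by rewrite divr_ge0// ltW. Qed.
Let kMk : k / M <= k. Proof. by rewrite ler_pdivrMr// ler_peMr. Qed.

Lemma is_derive_pert_cdf_y y x : is_derive y 1 (cdf ^~ x) (dens y x).
Proof.
have h : is_derive y 1 (fun t => wave (2 * M * t + - M)) (2 * M * dwave (2 * M * y + - M)).
  exact/is_derive1_comp_affine/is_derive_wave.
have := is_derive1_add (is_derive_id y 1)
  (is_derive1_scale (k / (2 * M ^+ 2)) (is_derive1_scale (Phi x) h)).
by congr is_derive; rewrite /pert_dens; field.
Qed.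

Lemma is_derive_pert_dens_y y x :
  is_derive y 1 (dens ^~ x) (2 * k * (Phi x * ddwave (2 * M * y + - M))).
Proof.
have h : is_derive y 1 (fun t => dwave (2 * M * t + - M)) (2 * M * ddwave (2 * M * y + - M)).
  exact/is_derive1_comp_affine/is_derive_dwave.
have := is_derive1_add (is_derive_cst (1 : R) y 1)
  (is_derive1_scale (k / M) (is_derive1_scale (Phi x) h)).
by congr is_derive; field.
Qed.

Let is_derive_Phi_mul c x : is_derive x 1 (fun t => Phi t * c) (dPhi x * c).
Proof.
have := is_derive1_mul (profile_derive hP x) (is_derive_cst c x 1).
by congr is_derive; rewrite mulr0 add0r mulrC.
Qed.

Lemma is_derive_pert_dens_x y x :
  is_derive x 1 (dens y) (k / M * (dPhi x * dwave (2 * M * y + - M))).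
Proof.
have := is_derive1_add (is_derive_cst (1 : R) x 1)
  (is_derive1_scale (k / M) (is_derive_Phi_mul (dwave (2 * M * y + - M)) x)).
by congr is_derive; rewrite add0r.
Qed.

Lemma is_derive_pert_cdf_x y x :
  is_derive x 1 (cdf y) (k / (2 * M ^+ 2) * (dPhi x * wave (2 * M * y + - M))).
Proof.
have := is_derive1_add (is_derive_cst y x 1)
  (is_derive1_scale (k / (2 * M ^+ 2)) (is_derive_Phi_mul (wave (2 * M * y + - M)) x)).
by congr is_derive; rewrite add0r.
Qed.

Lemma pert_dens_bound y x : `|dens y x - 1| <= 6 * k.
Proof.
rewrite /pert_dens addrAC subrr add0r normrM (normrM (Phi x)) (ger0_norm kM0).
have := profile_bound hP x; have := dwave_bound (2 * M * y + - M).
move: (normr_ge0 (Phi x)) (normr_ge0 (dwave (2 * M * y + - M))).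
set a := `|Phi x|; set b := `|dwave _|; move=> a0 b0 b6 a1.
have : a * b <= 6 by nra.
have : 0 <= a * b by exact: mulr_ge0.
by move: kM0 kMk; set c := k / M; set ab := a * b; nra.
Qed.

Lemma pert_dens_ge y x : 3/4 <= dens y x.
Proof. by have /ler_normlP[? ?] := pert_dens_bound y x; move: hk; lra. Qed.

Lemma pert_dens_le y x : dens y x <= 5/4.
Proof. by have /ler_normlP[? ?] := pert_dens_bound y x; move: hk; lra. Qed.

Lemma pert_dens_ge0 y x : 0 <= dens y x.
Proof. by apply: le_trans (pert_dens_ge y x); lra. Qed.

Lemma continuous_Phi : continuous Phi.
Proof. by move=> x; exact: is_derive1_continuous (profile_derive hP x). Qed.

Lemma pert_cdf0 x : cdf 0 x = 0.
Proof.
rewrite /pert_cdf wave0 ?mulr0 ?addr0//.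
by move: hM => ?; rewrite ?mulr0 add0r normrN ger0_norm; lra.
Qed.

Lemma pert_cdf1 x : cdf 1 x = 1.
Proof.
rewrite /pert_cdf wave0 ?mulr0 ?addr0//.
by move: hM => ?; rewrite ger0_norm; lra.
Qed.

Lemma integral_pert_dens y x : 0 <= y ->
  (\int[lebesgue_measure]_(t in `[0%R, y]) (dens t x)%:E = (cdf y x)%:E)%E.
Proof.
rewrite le_eqVlt => /orP[/eqP <-|y0].
  by rewrite set_itv1 integral_set1 pert_cdf0.
rewrite (continuous_FTC2 (F := cdf ^~ x))//.
- by rewrite pert_cdf0 sube0.
- apply: continuous_subspaceT => t.
  exact: is_derive1_continuous (is_derive_pert_dens_y t x).
- have cF t : {for t, continuous (cdf ^~ x)}.
    exact: is_derive1_continuous (is_derive_pert_cdf_y t x).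
  split.
  + by move=> t _; case: (is_derive_pert_cdf_y t x).
  + by apply: cvg_at_right_filter; exact: cF.
  + by apply: cvg_at_left_filter; exact: cF.
- by move=> t _; exact: derive1_is_derive (is_derive_pert_cdf_y t x).
Qed.

Lemma measurable_pert_dens :
  measurable_fun [set: R * R] (fun z : R * R => dens z.1 z.2).
Proof.
apply: measurable_funD => //; apply: measurable_funM => //.
apply: measurable_funM.
  apply: (measurableT_comp (f := Phi)) => //.
  by apply: continuous_measurable_fun; exact: continuous_Phi.
apply: (measurableT_comp (f := dwave)).
  by apply: continuous_measurable_fun; exact: continuous_dwave.
by apply: measurable_funD => //; exact: measurable_funM.
Qed.

Lemma integral_pert_dens_square :
  (\int[unif_square]_z (dens z.1 z.2)%:E = 1)%E.
Proof.
rewrite integral_unif_square; last 2 first.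
- by apply/measurable_EFinP; exact: measurable_pert_dens.
- by move=> z; rewrite lee_fin pert_dens_ge0.
under eq_integral do rewrite integral_pert_dens//= pert_cdf1.
rewrite integral_cst/=; last exact: measurable_itv.
by rewrite mul1e lebesgue_measure_itv/= lte_fin ltr01 oppr0 adde0.
Qed.

Definition pert_law : probability (R * R)%type R :=
  density_prob measurable_pert_dens (fun z => pert_dens_ge0 z.1 z.2)
    integral_pert_dens_square.

Let measurable_one : measurable_fun (@unit_itv R) (fun=> 1 : R).
Proof. exact: measurable_cst. Qed.

Let one_ge0 x : x \in `[0, 1] -> 0 <= (1 : R).
Proof. by []. Qed.

Let measurable_dens_square :
  measurable_fun (@unit_square R) (fun z : R * R => dens z.1 z.2).
Proof. by apply: measurable_funTS; exact: measurable_pert_dens. Qed.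

Let dens_ge0 y x : y \in `[0, 1] -> x \in `[0, 1] -> 0 <= dens y x.
Proof. by move=> _ _; exact: pert_dens_ge0. Qed.

Let dens_int1 x : x \in `[0, 1] ->
  (\int[lebesgue_measure]_(y in unit_itv) (dens y x)%:E = 1)%E.
Proof. by move=> _; rewrite integral_pert_dens// pert_cdf1. Qed.

Let pert_lawE (A : set (R * R)) : measurable A ->
  (pert_law A = \int[leb2]_(z in A `&` unit_square) (dens z.1 z.2 * 1)%:E)%E.
Proof.
move=> mA; rewrite /pert_law/= /density_prob integral_unif_squareE//.
- by apply: eq_integral => z _; rewrite mulr1.
- by apply/measurable_EFinP; exact: measurable_pert_dens.
- by move=> z; rewrite lee_fin pert_dens_ge0.
Qed.

Definition pert_distr : joint_distr R :=
  JointDistr measurable_one one_ge0 measurable_dens_square dens_ge0 dens_int1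
    pert_lawE.

Lemma cond_cdf_pert y x : 0 <= y -> cond_cdf pert_distr y x = cdf y x.
Proof. by move=> y0; rewrite /cond_cdf /Rintegral integral_pert_dens. Qed.

Lemma revenue_pert y x :
  0 <= y -> revenue pert_distr y x = pert_revenue k M (Phi x) y.
Proof. by move=> y0; rewrite /revenue cond_cdf_pert. Qed.

Lemma is_derive_pert_revenue x y :
  is_derive y 1 (pert_revenue k M (Phi x)) (1 - cdf y x - y * dens y x).
Proof.
have := is_derive1_mul (is_derive_id y 1) (is_derive1_add (is_derive_cst (1 : R) y 1)
  (is_derive1_scale (-1) (is_derive_pert_cdf_y y x))).
have -> : (fun t => id t * (cst 1 t + -1 * cdf t x)) = pert_revenue k M (Phi x).
  by apply/funext => t; rewrite /pert_revenue /pert_cdf /=; ring.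
by congr is_derive; rewrite /=; ring.
Qed.

Lemma opt_price_pertP x : opt_price pert_distr x \in `[0, 1] /\
  forall y, y \in `[0, 1] ->
    pert_revenue k M (Phi x) y <= pert_revenue k M (Phi x) (opt_price pert_distr x).
Proof.
have cr : {within `[0, 1], continuous (pert_revenue k M (Phi x))}.
  by apply: continuous_subspaceT => y; exact: is_derive1_continuous (is_derive_pert_revenue x y).
have [c c01 cmax] := EVT_max ler01 cr.
have ge0 (y : R) : y \in `[0, 1] -> 0 <= y by rewrite in_itv/= => /andP[].
have [p01 pmax] : [set y | y \in `[0, 1] /\
    forall y', y' \in `[0, 1] -> revenue pert_distr y' x <= revenue pert_distr y x]
    (opt_price pert_distr x).
  apply: xgetPex; exists c; split => // y y01.
  by rewrite !revenue_pert ?ge0//; exact: cmax.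
split=> // y y01; have := pmax y y01.
by rewrite !revenue_pert ?ge0.
Qed.

Definition max_revenue x : R := pert_revenue k M (Phi x) (opt_price pert_distr x).

Lemma max_revenue_ge x y : y \in `[0, 1] -> pert_revenue k M (Phi x) y <= max_revenue x.
Proof. by case: (opt_price_pertP x) => _; apply. Qed.

Lemma pert_revenue_lipschitz u v y : y \in `[0, 1] ->
  pert_revenue k M u y - pert_revenue k M v y <= `|u - v|.
Proof.
rewrite in_itv/= => /andP[y0 y1]; rewrite /pert_revenue.
set w := wave _; have wb : `|w| <= 1 by exact: wave_bound.
set c := k / (2 * M ^+ 2).
have c01 : 0 <= c <= 1.
  have M2 : 1 <= M ^+ 2 by exact: exprn_ege1.
  rewrite /c divr_ge0/=; [|by []|by lra].
  by rewrite ler_pdivrMr; move: hk; lra.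
rewrite (_ : _ - _ = (v - u) * (y * c * w)); last by ring.
rewrite (le_trans (ler_norm _))// normrM distrC ler_piMr//.
case/andP: c01 => c0 c1.
rewrite normrM (ger0_norm (mulr_ge0 y0 c0)).
by apply: mulr_ile1; [exact: mulr_ge0| |exact: mulr_ile1|].
Qed.

(** A maximum of functions that are 1-Lipschitz in v is 1-Lipschitz in v. The maximal revenue is
    thus continuous in x, hence integrable, with no study of how the optimal price varies with x. *)
Lemma max_revenue_lipschitz x x' : `|max_revenue x - max_revenue x'| <= `|Phi x - Phi x'|.
Proof.
have key (a b : R) : max_revenue a - max_revenue b <= `|Phi a - Phi b|.
  have [pa _] := opt_price_pertP a.
  apply: le_trans (pert_revenue_lipschitz (Phi a) (Phi b) pa).
  by rewrite lerD2l lerN2; exact: max_revenue_ge.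
rewrite ler_norml lerNl opprB; apply/andP; split; last exact: key.
by rewrite distrC; exact: key.
Qed.

Lemma continuous_max_revenue : continuous max_revenue.
Proof.
move=> x; apply/cvgrPdist_le => e e0.
have /cvgrPdist_le/(_ e e0) := @continuous_Phi x.
by apply: filterS => t; apply: le_trans; exact: max_revenue_lipschitz.
Qed.

Lemma pert_revenue_bound v y : `|v| <= 1 -> y \in `[0, 1] ->
  `|pert_revenue k M v y| <= 2.
Proof.
rewrite in_itv/= => v1 /andP[y0 y1]; rewrite /pert_revenue.
set w := wave _; have wb : `|w| <= 1 by exact: wave_bound.
set c := k / (2 * M ^+ 2).
have c01 : 0 <= c <= 1/100.
  have M2 : 1 <= M ^+ 2 by exact: exprn_ege1.
  rewrite /c divr_ge0/=; [|by []|by lra].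
  by rewrite ler_pdivrMr; move: hk; lra.
have vw : `|v * w| <= 1 by rewrite normrM mulr_ile1.
have cvw : `|c * (v * w)| <= 1/100.
  case/andP: c01 => c0 c1; rewrite normrM (ger0_norm c0).
  by have := normr_ge0 (v * w); nra.
rewrite normrM (ger0_norm y0); apply: (@le_trans _ _ (1 * 2)); last by rewrite mul1r.
apply: ler_pM => //; move: cvw; rewrite !ler_norml => /andP[? ?].
by apply/andP; split; lra.
Qed.

Lemma pert_revenue_half v : pert_revenue k M v (1/2) = 1/4.
Proof.
rewrite /pert_revenue (_ : 2 * M * (1/2) + - M = 0); last by field.
by rewrite /wave !mul0r mulr0; field.
Qed.

(** The prices 0 and 1 earn nothing, whereas 1/2 earns 1/4 for every profile because [wave] vanishes
    at 0. *)
Lemma opt_price_pert_interior x : opt_price pert_distr x \in `]0, 1[.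
Proof.
have [p01 _] := opt_price_pertP x.
have h : (1/2 : R) \in `[0, 1] by rewrite in_itv/=; lra.
have := max_revenue_ge x h; rewrite pert_revenue_half /max_revenue.
move: p01; rewrite !in_itv/= => /andP[q0 q1] r4.
apply/andP; split; rewrite lt_neqAle ?q0 ?q1 andbT; apply/eqP => e.
- by move: r4; rewrite -e /pert_revenue mul0r; lra.
- move: r4; rewrite e /pert_revenue; have := pert_cdf1 x.
  by rewrite /pert_cdf => ->; lra.
Qed.

End perturbation_calculus.

Lemma ler_normM {R : realType} (a b A B : R) :
  `|a| <= A -> `|b| <= B -> `|a * b| <= A * B.
Proof. by move=> aA bB; rewrite normrM ler_pM. Qed.

Lemma cst_sub_expectation d (T : measurableType d) (R : realType)
    (P : probability T R) (c B : R) (X : T -> R) :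
  measurable_fun setT X -> (forall w, `|X w| <= B) ->
  (c%:E - 'E_P[X] = \int[P]_w (c - X w)%:E)%E.
Proof.
move=> mX XB; rewrite unlock; under [RHS]eq_integral do rewrite EFinB.
rewrite integralB_EFin//.
- by rewrite integral_cst//= probability_setT mule1.
- exact: finite_measure_integrable_cst.
- apply: measurable_bounded_integrable => //.
    by rewrite (le_lt_trans (probability_le1 _ _)) ?ltry.
  exists B; split; first exact: num_real.
  by move=> t t2 x _; apply: le_trans (ltW t2).
Qed.

(** * Regularity and revenue losses of a perturbed distribution *)

Section perturbed_distribution.
Context {R : realType} (k M : R) (Phi dPhi : R -> R).
Hypotheses (hk : 0 <= k <= 1/100) (hM : 1 <= M) (hP : profile M Phi dPhi).

Local Notation dens := (pert_dens k M Phi).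
Local Notation cdf := (pert_cdf k M Phi).
Local Notation F := (pert_distr hk hM hP).
Local Notation leb := (@lebesgue_measure R).

Let Mgt0 : 0 < M. Proof. by move: hM; lra. Qed.
Let k0 : 0 <= k. Proof. by case/andP: hk. Qed.

Let itv01_ge0 (y : R) : y \in `[0, 1] -> 0 <= y.
Proof. by rewrite in_itv/= => /andP[]. Qed.

(** The density contributes at most 12 k and its slope at most 84 k. Strict concavity and both
    curvature conditions follow from this single estimate. *)
Lemma pert_curvature (y x : R) : y \in `[0, 1] ->
  `|2 * dens y x + y * d_y dens y x - 2| <= 100 * k.
Proof.
rewrite in_itv/= => /andP[y0 y1].
rewrite /d_y (derive1_is_derive (is_derive_pert_dens_y k Phi hM y x)).
have := pert_dens_bound hk hM hP y x.
set w := dens y x; set b := ddwave _.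
have h42 : `|2 * k * (y * (Phi x * b))| <= 84 * k.
  rewrite (_ : 84 * k = 2 * k * (1 * (1 * 42))); last by ring.
  apply: ler_normM; first by rewrite ger0_norm ?mulr_ge0.
  apply: ler_normM; first by rewrite ger0_norm.
  by apply: ler_normM; [exact: (profile_bound hP)|exact: ddwave_bound].
move: h42; rewrite (_ : 2 * k * (y * _) = y * (2 * k * (Phi x * b))); last by ring.
move=> /ler_normlP[u1 u2] /ler_normlP[w1 w2].
by rewrite ler_norml; apply/andP; split; lra.
Qed.

Lemma pert_lipschitz y y' x : `|dens y x - dens y' x| <= 100 * k * `|y - y'|.
Proof.
apply: (lipschitz_is_derive1 (f := dens ^~ x)
    (df := fun t => 2 * k * (Phi x * ddwave (2 * M * t + - M)))).
  by move=> t; exact: is_derive_pert_dens_y.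
move=> t; apply: (@le_trans _ _ (2 * k * (1 * 42))); last by move: k0; lra.
apply: ler_normM; first by rewrite ger0_norm ?mulr_ge0.
by apply: ler_normM; [exact: (profile_bound hP)|exact: ddwave_bound].
Qed.

(** The amplitude k / M meets the profile slope 8 M, so the bound 8 * 7 * k does not grow with M. *)
Lemma pert_x_bound (y x : R) : y \in `[0, 1] ->
  `|d_x cdf y x + y * d_x dens y x| <= 1.
Proof.
rewrite in_itv/= => /andP[y0 y1].
rewrite /d_x (derive1_is_derive (is_derive_pert_dens_x k hP y x)).
rewrite (derive1_is_derive (is_derive_pert_cdf_x k hP y x)).
have : `|wave (2 * M * y + - M)| <= 1 by exact: wave_bound.
have : `|dwave (2 * M * y + - M)| <= 6 by exact: dwave_bound.
set w := wave _; set w' := dwave _ => hw' hw.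
rewrite (_ : _ + _ = k * (dPhi x / M * (w / (2 * M) + y * w'))); last first.
  by field; exact: lt0r_neq0.
have d8 : `|dPhi x / M| <= 8.
  rewrite normrM normfV (ger0_norm (ltW Mgt0)) ler_pdivrMr//.
  exact: (profile_dbound hP).
have w7 : `|w / (2 * M) + y * w'| <= 7.
  apply: (le_trans (ler_normD _ _)); rewrite (_ : 7 = 1 + 6); last by ring.
  apply: lerD; last first.
    rewrite (_ : 6 = 1 * 6); last by ring.
    by apply: ler_normM => //; rewrite ger0_norm.
  rewrite normrM normfV (ger0_norm (_ : 0 <= 2 * M)); last by rewrite mulr_ge0// ltW.
  by rewrite ler_pdivrMr ?mulr_gt0//; move: hM hw; lra.
apply: (@le_trans _ _ (k * (8 * 7))); last by move: hk; lra.
by apply: ler_normM; [rewrite ger0_norm|exact: ler_normM].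
Qed.

(** The second derivative of the revenue is at most 100 k - 2 < 0 on [0, 1] by [pert_curvature]. *)
Lemma pert_revenue_concave x : strictly_concave_on01 (pert_revenue k M (Phi x)).
Proof.
apply: (strictly_concave_is_derive1 (df := fun y => 1 - cdf y x - y * dens y x)).
  by move=> t _; exact: is_derive_pert_revenue.
move=> s t; rewrite !in_itv/= => /andP[s0 s1] /andP[t0 t1] st.
have hD (y : R) : is_derive y 1 (fun y => 1 - cdf y x - y * dens y x)
    (- (2 * dens y x + y * d_y dens y x)).
  rewrite /d_y (derive1_is_derive (is_derive_pert_dens_y k Phi hM y x)).
  have h := is_derive1_mul (is_derive_id y 1) (is_derive_pert_dens_y k Phi hM y x).
  have := is_derive1_add (is_derive1_add (is_derive_cst (1 : R) y 1)
    (is_derive1_scale (-1) (is_derive_pert_cdf_y k Phi hM y x))) (is_derive1_scale (-1) h).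
  have -> : (fun t => cst 1 t + -1 * cdf t x + -1 * (id t * dens t x)) =
      (fun y => 1 - cdf y x - y * dens y x).
    by apply/funext => z; rewrite /=; ring.
  by congr is_derive; rewrite /=; ring.
have ct : {within `[s, t], continuous (fun y => 1 - cdf y x - y * dens y x)}.
  by apply: continuous_subspaceT => y; exact: is_derive1_continuous (hD y).
have [c] := MVT st (fun y _ => hD y) ct.
rewrite in_itv/= => /andP[sc tc].
have c01 : c \in `[0, 1] by rewrite in_itv/=; lra.
have /ler_normlP[c1 c2] := pert_curvature x c01.
move=> h; rewrite -subr_lt0 h mulNr oppr_lt0 mulr_gt0 ?subr_gt0//.
by move: c1 hk => ? /andP[? ?]; lra.
Qed.

Lemma continuous_affine_fst : continuous (fun w : R * R => 2 * M * w.1 + - M).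
Proof.
move=> w; apply: cvgD; last exact: cvg_cst.
by apply: cvgM; [exact: cvg_cst|exact: cvg_fst].
Qed.

Lemma pert_C1 : C1_on setT dens.
Proof.
split => -[y x] _ /=.
  by split; [case: (is_derive_pert_dens_y k Phi hM y x)|case: (is_derive_pert_dens_x k hP y x)].
split.
- have -> : (fun w : R * R => d_y dens w.1 w.2) =
      (fun w => 2 * k * (Phi w.2 * ddwave (2 * M * w.1 + - M))).
    by apply/funext => w; rewrite /d_y (derive1_is_derive (is_derive_pert_dens_y k Phi hM w.1 w.2)).
  apply: cvgM; first exact: cvg_cst.
  apply: cvgM.
    apply: (continuous_comp (f := snd) (g := Phi)); first exact: cvg_snd.
    exact: (continuous_Phi hP).
  apply: (continuous_comp (f := fun w : R * R => 2 * M * w.1 + - M) (g := ddwave)).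
    exact: continuous_affine_fst.
  exact: continuous_ddwave.
- have -> : (fun w : R * R => d_x dens w.1 w.2) =
      (fun w => k / M * (dPhi w.2 * dwave (2 * M * w.1 + - M))).
    by apply/funext => w; rewrite /d_x (derive1_is_derive (is_derive_pert_dens_x k hP w.1 w.2)).
  apply: cvgM; first exact: cvg_cst.
  apply: cvgM.
    apply: (continuous_comp (f := snd) (g := dPhi)); first exact: cvg_snd.
    exact: (profile_dcont hP).
  apply: (continuous_comp (f := fun w : R * R => 2 * M * w.1 + - M) (g := dwave)).
    exact: continuous_affine_fst.
  exact: continuous_dwave.
Qed.

(** The uniform distribution has zero slopes, curvature 2 and marginal density 1. A perturbation of
    size 100 k stays within the slack this leaves, and no bound involves M, so one [k] serves for
    every number of cells. *)
Lemma pert_regular (C0 Cbar Cbar' Cunder Cstar : R) :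
  100 * k <= C0 -> 100 * k <= 2 - Cstar -> 100 * k <= Cbar - 2 ->
  Cunder <= 1 -> 1 <= Cbar' -> regular C0 Cbar Cbar' Cunder Cstar F.
Proof.
move=> kC0 kCstar kCbar hCu hCbar'.
have Cbar1 : 1 <= Cbar by move: k0; lra.
have dery (y x : R) : derivable_y dens y x by case: (is_derive_pert_dens_y k Phi hM y x).
split.
- move=> y y' x _ _ _; apply: (le_trans (pert_lipschitz _ _ _)).
  exact: ler_wpM2r.
- move=> x _ a b t a01 b01 ab t01.
  rewrite !revenue_pert ?itv01_ge0//; first exact: pert_revenue_concave.
  move: a01 b01 t01; rewrite !in_itv/= => /andP[? ?] /andP[? ?] /andP[? ?]; nra.
- apply: aeW => -[y x] [/= y01 _]; split; first exact: dery.
  by have /ler_normlP[] := pert_curvature x y01; lra.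
- by move=> x _; exact: opt_price_pert_interior.
- exists setT, dens; split => //; [exact: openT|exact: pert_C1].
- apply: aeW => -[y x] [/= y01 _]; split; first exact: dery.
  have /ler_normlP[? ?] := pert_curvature x y01.
  have k' := k0; rewrite ler_norml; apply/andP; split; first lra.
  lra.
- apply: aeW => -[y x] [/= y01 _].
  have cdfE : cond_cdf F y = cdf y.
    by apply/funext => t; rewrite cond_cdf_pert// itv01_ge0.
  have hx : d_x (cond_cdf F) y x = d_x cdf y x by rewrite /d_x cdfE.
  split.
  + by rewrite /derivable_x cdfE; case: (is_derive_pert_cdf_x k hP y x).
  + by case: (is_derive_pert_dens_x k hP y x).
  + by rewrite hx; apply: le_trans Cbar1; exact: pert_x_bound.
- by move=> x _; rewrite /= hCu hCbar'.
Qed.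

Let leb_fin : (leb unit_itv < +oo)%E.
Proof. by rewrite lebesgue_measure_itv/= lte_fin ltr01 -EFinB ltry. Qed.

Let m01 : measurable (unit_itv : set (measurableTypeR R)).
Proof. exact: measurable_itv. Qed.

Lemma measurable_pert_revenue p : is_pricing p ->
  measurable_fun unit_itv (fun x => pert_revenue k M (Phi x) (p x)).
Proof.
move=> [mp _]; rewrite /pert_revenue.
have mPhi : measurable_fun (@unit_itv R) Phi.
  apply: measurable_funTS; apply: continuous_measurable_fun.
  exact: (continuous_Phi hP).
have mw : measurable_fun unit_itv (fun x => wave (2 * M * p x + - M)).
  apply: (measurableT_comp (f := wave)).
    by apply: continuous_measurable_fun; exact: continuous_wave.
  by apply: measurable_funD => //; exact: measurable_funM.
apply: measurable_funM => //; apply: measurable_funB => //.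
by apply: measurable_funD => //; apply: measurable_funM => //; exact: measurable_funM.
Qed.

Lemma integrable_pert_revenue p : is_pricing p ->
  leb.-integrable unit_itv (EFin \o (fun x => pert_revenue k M (Phi x) (p x))).
Proof.
move=> hp; apply: measurable_bounded_integrable => //.
  exact: measurable_pert_revenue.
exists 2; split; first exact: num_real.
move=> t t2 x x01; apply: le_trans (ltW t2).
by apply: pert_revenue_bound => //; [exact: (profile_bound hP)|exact: hp.2].
Qed.

Lemma integrable_max_revenue :
  leb.-integrable unit_itv (EFin \o max_revenue hk hM hP).
Proof.
apply: measurable_bounded_integrable => //.
  by apply: measurable_funTS; apply: continuous_measurable_fun; exact: continuous_max_revenue.
exists 2; split; first exact: num_real.
move=> t t2 x x01; apply: le_trans (ltW t2).
apply: pert_revenue_bound => //; first exact: (profile_bound hP).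
by case: (opt_price_pertP hk hM hP x).
Qed.

Lemma expected_revenue_pert p : is_pricing p ->
  expected_revenue p F = \int[leb]_(x in unit_itv) pert_revenue k M (Phi x) (p x).
Proof.
move=> hp; apply: eq_Rintegral => x; rewrite inE => x01.
by rewrite /= mulr1 revenue_pert// itv01_ge0//; exact: hp.2.
Qed.

Lemma expected_revenue_opt :
  expected_revenue (opt_price F) F = \int[leb]_(x in unit_itv) max_revenue hk hM hP x.
Proof.
apply: eq_Rintegral => x _; rewrite /= mulr1 revenue_pert// itv01_ge0//.
by case: (opt_price_pertP hk hM hP x).
Qed.

Definition revenue_loss p x : R := max_revenue hk hM hP x - pert_revenue k M (Phi x) (p x).

Lemma revenue_loss_ge0 p x : is_pricing p -> x \in `[0, 1] -> 0 <= revenue_loss p x.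
Proof. by move=> hp x01; rewrite subr_ge0; apply: max_revenue_ge; exact: hp.2. Qed.

Lemma measurable_revenue_loss p : is_pricing p ->
  measurable_fun unit_itv (revenue_loss p).
Proof.
move=> hp; apply: measurable_funB; last exact: measurable_pert_revenue.
by apply: measurable_funTS; apply: continuous_measurable_fun; exact: continuous_max_revenue.
Qed.

Lemma expected_lossE p : is_pricing p ->
  ((expected_revenue (opt_price F) F - expected_revenue p F)%:E =
   \int[leb]_(x in unit_itv) (revenue_loss p x)%:E)%E.
Proof.
move=> hp; rewrite expected_revenue_opt expected_revenue_pert//.
rewrite -RintegralB//; [|exact: integrable_max_revenue|exact: integrable_pert_revenue].
rewrite /Rintegral fineK//; apply: integrable_fin_num => //.
exact: (integrableB m01 integrable_max_revenue (integrable_pert_revenue hp)).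
Qed.

Lemma expected_loss_ge0 p : is_pricing p ->
  0 <= expected_revenue (opt_price F) F - expected_revenue p F.
Proof.
move=> hp; rewrite -lee_fin expected_lossE//; apply: integral_ge0 => x x01.
by rewrite lee_fin revenue_loss_ge0.
Qed.

Lemma expected_revenue_bound p : is_pricing p -> `|expected_revenue p F| <= 2.
Proof.
move=> hp; rewrite expected_revenue_pert//.
apply: le_trans (le_normr_Rintegral m01 (integrable_pert_revenue hp)) _.
rewrite -lee_fin /Rintegral fineK; last first.
  by apply: integrable_fin_num => //; exact: (integrable_abse (integrable_pert_revenue hp)).
apply: (@le_trans _ _ (\int[leb]_(x in unit_itv) cst 2%:E x)%E).
  apply: ge0_le_integral => //.
  - by apply/measurable_EFinP; apply: measurableT_comp => //; exact: measurable_pert_revenue.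
  - move=> x x01; rewrite lee_fin; apply: pert_revenue_bound => //.
      exact: (profile_bound hP).
    exact: hp.2.
rewrite integral_cst//= lebesgue_measure_itv/= lte_fin ltr01 -EFinB subr0.
by rewrite mule1.
Qed.

(** Revenues are uniformly bounded, so the difference goes under the integral, where it is
    nonnegative. *)
Lemma regretE n (p : n.-tuple (R * R) -> R -> R) :
  (forall data, is_pricing (p data)) ->
  measurable_fun setT (fun data => expected_revenue (p data) F) ->
  (regret p F = \int[iid_law (joint_law F) n]_data
    (expected_revenue (opt_price F) F - expected_revenue (p data) F)%:E)%E.
Proof.
move=> hp mp; apply: cst_sub_expectation mp _ => data.
by apply: expected_revenue_bound.
Qed.

End perturbed_distribution.

(** * The hypercube of perturbations *)

Section hypercube.
Context {R : realType} (m : nat).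
Hypothesis m_gt0 : (0 < m)%N.
Implicit Types (w : {ffun 'I_m -> bool}) (i j : 'I_m) (x y k v : R).

Local Notation M := (m%:R : R).

Let M1 : 1 <= M. Proof. by rewrite ler1n. Qed.
Let Mgt0 : 0 < M. Proof. by rewrite ltr0n. Qed.

(** The affine map sending the j-th cell [j / m, (j + 1) / m] onto [-1, 1]. *)
Definition cell j x : R := 2 * M * x + - (2 * j%:R + 1).

Lemma cell_disjoint i j x : `|cell i x| < 1 -> `|cell j x| < 1 -> i = j.
Proof.
move=> /ltr_normlP[i1 i2] /ltr_normlP[j1 j2]; apply/val_inj/eqP.
have ij : (i%:R : R) < (j.+1)%:R.
  by move: i1 i2 j1 j2; rewrite /cell -natr1; lra.
have ji : (j%:R : R) < (i.+1)%:R.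
  by move: i1 i2 j1 j2; rewrite /cell -natr1; lra.
by move: ij ji; rewrite !ltr_nat !ltnS eqn_leq => -> ->.
Qed.

(** At most one term is nonzero, so the bound is that of one term and not of m terms. *)
Lemma sum_signed_disjoint_bound w (a : 'I_m -> R) (B : R) : 0 <= B ->
  (forall i j, a i != 0 -> a j != 0 -> i = j) -> (forall i, `|a i| <= B) ->
  `|\sum_i (-1) ^+ w i * a i| <= B.
Proof.
move=> B0 disj aB; have [[j aj]|none] := pselect (exists j, a j != 0).
  rewrite (bigD1 j)//= big1 ?addr0; first by rewrite normrM normr_sign mul1r.
  move=> i ij; apply/eqP; rewrite mulf_eq0; apply/orP; right.
  by apply: contraNT ij => ai; apply/eqP; exact: disj.
rewrite big1 ?normr0// => i _; apply/eqP; rewrite mulf_eq0; apply/orP; right.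
by apply/negP => /negP ai; apply: none; exists i.
Qed.

Definition cube_profile w x : R := \sum_j (-1) ^+ w j * bump (cell j x).

Definition cube_dprofile w x : R :=
  \sum_j (-1) ^+ w j * (2 * M * dbump (cell j x)).

Let cell_lt1 (f : R -> R) : (forall u, 1 <= `|u| -> f u = 0) ->
  forall j x, f (cell j x) != 0 -> `|cell j x| < 1.
Proof.
by move=> f0 j x; apply: contraNT; rewrite -leNgt => c1; rewrite f0.
Qed.

Lemma cube_profileP w : profile M (cube_profile w) (cube_dprofile w).
Proof.
split.
- move=> x; apply: is_derive1_sum => j; apply: is_derive1_scale.
  by apply: is_derive1_comp_affine; exact: is_derive_bump.
- apply: continuous_big => [|j _ x]; first exact: add_continuous.
  apply: cvgM; first exact: cvg_cst.
  apply: cvgM; first exact: cvg_cst.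
  apply: (continuous_comp (f := cell j) (g := dbump)); last exact: continuous_dbump.
  exact: is_derive1_continuous (is_derive1_affine _ _ x).
- move=> x; apply: sum_signed_disjoint_bound => //.
    move=> i j /(cell_lt1 (@bump0 R)) hi /(cell_lt1 (@bump0 R)) hj.
    exact: cell_disjoint hi hj.
  by move=> j; rewrite ger0_norm ?bump_ge0// bump_le1.
- move=> x; apply: sum_signed_disjoint_bound.
  + by rewrite mulr_ge0// ltW.
  + have nz u : 2 * M * dbump u != 0 -> dbump u != 0.
      by apply: contra_neq => ->; rewrite mulr0.
    move=> i j /nz/(cell_lt1 (@dbump0 R)) hi /nz/(cell_lt1 (@dbump0 R)) hj.
    exact: cell_disjoint hi hj.
  + move=> j; rewrite (_ : 8 * M = 2 * M * 4); last by ring.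
    apply: ler_normM; last exact: dbump_bound.
    by rewrite ger0_norm// mulr_ge0// ltW.
Qed.

Definition flip j w : {ffun 'I_m -> bool} :=
  [ffun i => if i == j then ~~ w i else w i].

Lemma flipE j w i : flip j w i = if i == j then ~~ w i else w i.
Proof. by rewrite ffunE. Qed.

Lemma flipK j : involutive (flip j).
Proof.
by move=> w; apply/ffunP => i; rewrite !flipE; case: eqP => // _; exact: negbK.
Qed.

Lemma cube_profile_flip_sub j w x :
  cube_profile w x - cube_profile (flip j w) x = 2 * (-1) ^+ w j * bump (cell j x).
Proof.
rewrite /cube_profile (bigD1 j)//= [X in _ - X](bigD1 j)//= flipE eqxx.
rewrite [X in _ - (_ + X)](eq_bigr (fun i => (-1) ^+ w i * bump (cell i x))); last first.
  by move=> i ij; rewrite flipE (negbTE ij).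
by rewrite signrN; ring.
Qed.

Lemma cube_profile_in_cell j w x : `|cell j x| < 1 ->
  cube_profile w x = (-1) ^+ w j * bump (cell j x).
Proof.
move=> hj; rewrite /cube_profile (bigD1 j)//= big1 ?addr0// => i ij.
rewrite bump0 ?mulr0// leNgt; apply: contraNN ij => hi.
by apply/eqP; exact: cell_disjoint hi hj.
Qed.

(* Opposite profiles have revenues averaging to [y (1 - y)] at every common
   price, whereas moving the price by [e / (2 M)] towards the respective
   optimum gains to first order in [e] and loses to second order. *)
Lemma two_point_gain k v : 0 <= k <= 1/100 -> 1/2 <= `|v| <= 1 ->
  exists y1 y2, [/\ y1 \in `[0, 1], y2 \in `[0, 1] &
    forall y, pert_revenue k M v y + pert_revenue k M (- v) y +
      k ^+ 2 / (128 * M ^+ 2) <=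
      pert_revenue k M v y1 + pert_revenue k M (- v) y2].
Proof.
move=> /andP[k0 k1] /andP[v2 v1].
(* For a shift e, the gain is about k v e / (2 M^2) and the loss is e^2 / (2 M^2). With e = k v / 4,
   [wave_lower] secures a gain of e^2 / M^2, which leaves e^2 / (2 M^2) = k^2 v^2 / (32 M^2), and
   v^2 >= 1/4. *)
pose e := k * v / 4; pose d := e / (2 * M).
have e1 : `|e| <= 1/10.
  apply: (@le_trans _ _ (1/100 * 1 * 4^-1)); last by lra.
  apply: ler_normM; last by rewrite ger0_norm.
  by apply: ler_normM => //; rewrite ger0_norm.
have d2 : `|d| <= 1/2.
  rewrite /d normrM normfV (ger0_norm (_ : 0 <= 2 * M)); last by rewrite mulr_ge0// ltW.
  by rewrite ler_pdivrMr ?mulr_gt0//; move: M1; lra.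
have /ler_normlP[d3 d4] := d2.
exists (1/2 - d), (1/2 + d); split.
- by rewrite in_itv/=; apply/andP; split; lra.
- by rewrite in_itv/=; apply/andP; split; lra.
have M0 : M != 0 by exact: lt0r_neq0.
move=> y; rewrite /pert_revenue.
rewrite (_ : 2 * M * (1/2 - d) + - M = - e); last by rewrite /d; field.
rewrite (_ : 2 * M * (1/2 + d) + - M = e); last by rewrite /d; field.
rewrite waveN; have := wave_lower e1; set we := wave e; set wy := wave _ => hw.
have -> : forall c, (1/2 - d) * (1 - (1/2 - d + c * (v * - we))) +
    (1/2 + d) * (1 - (1/2 + d + c * (- v * we))) = 1/2 - 2 * d ^+ 2 + c * v * we.
  by move=> c; field.
have -> : y * (1 - (y + k / (2 * M ^+ 2) * (v * wy))) +
    y * (1 - (y + k / (2 * M ^+ 2) * (- v * wy))) = 2 * (y * (1 - y)) by ring.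
have -> : k / (2 * M ^+ 2) * v * we = 2 / M ^+ 2 * (e * we) by rewrite /e; field.
have -> : 2 * d ^+ 2 = e ^+ 2 / (2 * M ^+ 2) by rewrite /d; field.
have v4 : 1/4 <= v ^+ 2.
  by rewrite -(real_normK (num_real v)); have := normr_ge0 v; nra.
have e2 : k ^+ 2 / (128 * M ^+ 2) <= e ^+ 2 / (2 * M ^+ 2).
  rewrite (_ : e ^+ 2 / _ = k ^+ 2 / (128 * M ^+ 2) * (4 * v ^+ 2)); last by rewrite /e; field.
  by rewrite ler_peMr ?divr_ge0 ?sqr_ge0 ?mulr_ge0 ?sqr_ge0//; lra.
have e3 : e ^+ 2 / (2 * M ^+ 2) * 2 <= 2 / M ^+ 2 * (e * we).
  rewrite (_ : e ^+ 2 / _ * 2 = 2 / M ^+ 2 * (e ^+ 2 / 2)); last by field.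
  by apply: ler_wpM2l => //; rewrite divr_ge0 ?sqr_ge0.
have y4 : 2 * (y * (1 - y)) <= 1/2 by have := sqr_ge0 (y - 1/2); nra.
by move: e2 e3 y4; lra.
Qed.

End hypercube.

(** The two-point testing bound at a single sample: [a] and [b] are the likelihoods and [l], [l']
    the losses of the same decision under either distribution. *)
Lemma min_mul_le {R : realType} (a b l l' c : R) : 0 <= a -> 0 <= b ->
  0 <= l -> 0 <= l' -> c <= l + l' -> c * Num.min a b <= a * l + b * l'.
Proof.
move=> a0 b0 l0 l'0 cl; apply: (@le_trans _ _ ((l + l') * Num.min a b)).
  by rewrite ler_wpM2r// le_min a0 b0.
rewrite mulrDl lerD// mulrC ler_wpM2r// ge_min lexx//.
by rewrite orbT.
Qed.

(** If x is the smaller and y the larger of the two, the arithmetic-geometric inequality gives h <=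
    x + y / 4. Applied to likelihoods and integrated, the terms a / 4 and b / 4 cost 1/2 in
    total. *)
Lemma affinity_le_min {R : realType} (a b h : R) :
  0 <= a -> 0 <= b -> 0 <= h -> h ^+ 2 <= a * b ->
  h <= Num.min a b + (a / 4 + b / 4).
Proof.
have key x y : 0 <= x -> x <= y -> 0 <= h -> h ^+ 2 <= x * y ->
    h <= x + (x / 4 + y / 4).
  move=> x0 xy h0 hxy; rewrite leNgt; apply/negP => lt.
  have h1 : x + y / 4 < h by lra.
  have h2 : (x + y / 4) ^+ 2 < h ^+ 2 by rewrite ltr_pXn2r// nnegrE; lra.
  have : 0 <= (x - y / 4) ^+ 2 by exact: sqr_ge0.
  nra.
move=> a0 b0 h0 hab; case: (leP a b) => ab; first exact: key.
by rewrite [a / 4 + _]addrC; apply: key => //; [exact: ltW|rewrite mulrC].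
Qed.

Lemma bernoulli_le {R : realType} (t : R) n : 0 <= t <= 1 ->
  1 - n%:R * t <= (1 - t) ^+ n.
Proof.
move=> /andP[t0 t1]; elim: n => [|n IH]; first by rewrite mul0r subr0 expr0.
rewrite exprS -natr1; have : 0 <= n%:R * (t * t) by rewrite !mulr_ge0.
have : (1 - t) * (1 - n%:R * t) <= (1 - t) * (1 - t) ^+ n by rewrite ler_wpM2l// subr_ge0.
lra.
Qed.

(** The support of the rescaled function has length 1 / M. *)
Lemma le_integral_rescaled_bump {R : realType} (f : R -> R) (M b B : R) :
  0 < M -> 0 <= B -> measurable_fun setT f -> (forall u, 0 <= f u <= B) ->
  (forall u, 1 <= `|u| -> f u = 0) ->
  (\int[@lebesgue_measure R]_(x in unit_itv) (f (2 * M * x + b))%:E <= (B / M)%:E)%E.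
Proof.
move=> M0 B0 mf fB f0.
pose J : set (measurableTypeR R) := `](-1 - b) / (2 * M), (1 - b) / (2 * M)[%classic.
have mJ : measurable J by exact: measurable_itv.
have MM : 0 < 2 * M by rewrite mulr_gt0.
have m01 : measurable (unit_itv : set (measurableTypeR R)) by exact: measurable_itv.
apply: (@le_trans _ _ (\int[@lebesgue_measure R]_(x in unit_itv) (B%:E * (\1_J x)%:E))%E).
  apply: ge0_le_integral => //.
  - by move=> x _; rewrite lee_fin; case/andP: (fB (2 * M * x + b)).
  - apply/measurable_EFinP/measurable_funTS; apply: (measurableT_comp (f := f)) => //.
    by apply: measurable_funD => //; exact: measurable_funM.
  - apply: emeasurable_funM => //; apply: measurable_funTS.
    exact: (measurableT_comp _ (measurable_indic mJ)).
  - move=> x _; rewrite -EFinM lee_fin; case/andP: (fB (2 * M * x + b)) => fx0 fxB.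
    rewrite indicE; case: (boolP (x \in J)) => [_|]; first by rewrite mulr1.
    rewrite notin_setE /J/= in_itv/= => /negP xJ; rewrite mulr0 f0//.
    rewrite leNgt; apply: contra xJ => /ltr_normlP[h1 h2].
    by rewrite ltr_pdivrMr// ltr_pdivlMr//; apply/andP; split; lra.
have mI : measurable_fun unit_itv (fun x => (\1_J x)%:E : \bar R).
  by apply: measurable_funTS; exact: (measurableT_comp _ (measurable_indic mJ)).
rewrite ge0_integralZl//.
rewrite integral_indic//; apply: (@le_trans _ _ (B%:E * lebesgue_measure J)%E).
  by rewrite lee_wpmul2l ?lee_fin// measureIl.
rewrite lebesgue_measure_itv/= lte_fin ltr_pM2r ?invr_gt0// ifT; last by lra.
rewrite -EFinB -EFinM lee_fin le_eqVlt; apply/orP; left; apply/eqP.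
by field; exact: lt0r_neq0.
Qed.

(** * Indistinguishable pairs and averaging over the cube *)

Section assouad.
Context {R : realType} (m : nat) (k : R).
Hypotheses (m_gt0 : (0 < m)%N) (hk : 0 <= k <= 1/100).
Implicit Types (w : {ffun 'I_m -> bool}) (j : 'I_m) (x y : R) (z : R * R).

Local Notation M := (m%:R : R).
Local Notation leb := (@lebesgue_measure R).

Let M1 : 1 <= M. Proof. by rewrite ler1n. Qed.
Let Mgt0 : 0 < M. Proof. by rewrite ltr0n. Qed.
Let M0 : M != 0. Proof. exact: lt0r_neq0. Qed.

Let m01 : measurable (unit_itv : set (measurableTypeR R)).
Proof. exact: measurable_itv. Qed.

Definition cube_distr w : joint_distr R := pert_distr hk M1 (@cube_profileP R m w).

Definition cube_dens w z : R := pert_dens k M (cube_profile w) z.1 z.2.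

Lemma cube_dens_itv w z : 3/4 <= cube_dens w z <= 5/4.
Proof.
have hP := @cube_profileP R m w.
by rewrite /cube_dens (pert_dens_ge hk M1 hP) (pert_dens_le hk M1 hP).
Qed.

Lemma cube_dens_ge0 w z : 0 <= cube_dens w z.
Proof. by case/andP: (cube_dens_itv w z) => h _; apply: le_trans h; lra. Qed.

Lemma measurable_cube_dens w : measurable_fun setT (cube_dens w).
Proof. exact: (measurable_pert_dens k (@cube_profileP R m w)). Qed.

Lemma integral_cube_dens w : (\int[unif_square]_z (cube_dens w z)%:E = 1)%E.
Proof. exact: (integral_pert_dens_square hk M1 (@cube_profileP R m w)). Qed.

(** Up to a constant factor, a stand-in for the integrand of the squared Hellinger distance, the
    densities being close to 1. *)
Definition cube_gap w j z : R := ((cube_dens w z - cube_dens (flip j w) z) / 2) ^+ 2.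

(* A polynomial minorant of the geometric mean of the two densities, so that
   the Hellinger affinity is bounded below without square roots. *)
Definition affinity w j z : R :=
  (cube_dens w z + cube_dens (flip j w) z) / 2 - cube_gap w j z.

Lemma affinity_ge0 w j z : 0 <= affinity w j z.
Proof.
rewrite /affinity /cube_gap.
have /andP[? ?] := cube_dens_itv w z; have /andP[? ?] := cube_dens_itv (flip j w) z.
nra.
Qed.

(** With s the half-sum and e the gap, the product of the densities is s^2 - e, while (s - e)^2 =
    s^2 - e (2 s - e) and 2 s - e >= 1. *)
Lemma affinity_sqr w j z :
  affinity w j z ^+ 2 <= cube_dens w z * cube_dens (flip j w) z.
Proof.
rewrite /affinity /cube_gap; have := cube_dens_itv w z; have := cube_dens_itv (flip j w) z.
move: (cube_dens w z) (cube_dens _ z) => a b /andP[b1 b2] /andP[a1 a2].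
set s := (a + b) / 2; set e := ((a - b) / 2) ^+ 2.
have -> : a * b = s ^+ 2 - e by rewrite /s /e; field.
have e0 : 0 <= e by exact: sqr_ge0.
have e1 : e <= 1/16 by rewrite /e; nra.
have s1 : 3/4 <= s by rewrite /s; lra.
nra.
Qed.

Lemma measurable_cube_gap w j : measurable_fun setT (cube_gap w j).
Proof.
apply: measurable_funX; apply: measurable_funM => //.
by apply: measurable_funB; exact: measurable_cube_dens.
Qed.

Lemma measurable_affinity w j : measurable_fun setT (affinity w j).
Proof.
apply: measurable_funB; last exact: measurable_cube_gap.
by apply: measurable_funM => //; apply: measurable_funD; exact: measurable_cube_dens.
Qed.

Lemma cube_gapE w j y x : cube_gap w j (y, x) =
  (k / M) ^+ 2 * bump (cell j x) ^+ 2 * dwave (2 * M * y + - M) ^+ 2.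
Proof.
have h : cube_dens w (y, x) - cube_dens (flip j w) (y, x) =
    k / M * ((cube_profile w x - cube_profile (flip j w) x) * dwave (2 * M * y + - M)).
  by rewrite /cube_dens /pert_dens /=; ring.
rewrite /cube_gap h cube_profile_flip_sub.
have s2 : ((-1) ^+ w j : R) ^+ 2 = 1 by rewrite sqrr_sign.
rewrite (_ : _ / 2 = (k / M * bump (cell j x) * dwave (2 * M * y + - M)) * (-1) ^+ w j).
  by rewrite exprMn s2 mulr1 !exprMn.
by field.
Qed.

(** The squared amplitude gives (k / M)^2 and the support gives a factor of order 1 / M in each
    variable. This is the origin of the threshold n <= m^4. *)
Lemma integral_cube_gap w j :
  (\int[unif_square]_z (cube_gap w j z)%:E <= (36 * k ^+ 2 / M ^+ 4)%:E)%E.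
Proof.
rewrite integral_unif_square; last 2 first.
- by apply/measurable_EFinP; exact: measurable_cube_gap.
- by move=> z; rewrite lee_fin sqr_ge0.
have mdw : measurable_fun setT (fun u : R => dwave u ^+ 2).
  by apply: measurable_funX; apply: continuous_measurable_fun; exact: continuous_dwave.
have mbu : measurable_fun setT (fun u : R => bump u ^+ 2).
  by apply: measurable_funX; apply: continuous_measurable_fun; exact: continuous_bump.
have inner : (\int[leb]_(y in unit_itv) (dwave (2 * M * y + - M) ^+ 2)%:E <= (36 / M)%:E)%E.
  apply: (le_integral_rescaled_bump (f := fun u => dwave u ^+ 2)) => //.
    move=> u; rewrite sqr_ge0/= -(real_normK (num_real _)).
    by have := dwave_bound u; have := normr_ge0 (dwave u); nra.
  by move=> u u1; rewrite dwave0// expr0n.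
have outer : (\int[leb]_(x in unit_itv) (bump (cell j x) ^+ 2)%:E <= (1 / M)%:E)%E.
  apply: (le_integral_rescaled_bump (f := fun u => bump u ^+ 2)) => //.
    move=> u; rewrite sqr_ge0/=.
    by have := bump_le1 u; have := bump_ge0 u; nra.
  by move=> u u1; rewrite bump0// expr0n.
have ge0k : 0 <= (k / M) ^+ 2 by exact: sqr_ge0.
have mcell : measurable_fun (@unit_itv R) (fun x => bump (cell j x) ^+ 2).
  apply: measurable_funTS; apply: (measurableT_comp (f := fun u => bump u ^+ 2)) => //.
  by apply: measurable_funD => //; exact: measurable_funM.
have U0 : (0 <= \int[leb]_(y in unit_itv) (dwave (2 * M * y + - M) ^+ 2)%:E)%E.
  by apply: integral_ge0 => y _; rewrite lee_fin sqr_ge0.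
move: inner U0; set U := (\int[leb]_(y in unit_itv) _)%E => inner U0.
have -> : (\int[leb]_(x in unit_itv) \int[leb]_(y in unit_itv) (cube_gap w j (y, x))%:E =
    \int[leb]_(x in unit_itv) (((k / M) ^+ 2)%:E * ((bump (cell j x) ^+ 2)%:E * U)))%E.
  apply: eq_integral => x _; rewrite muleA -EFinM -ge0_integralZl//.
  - by apply: eq_integral => y _; rewrite cube_gapE EFinM.
  - apply/measurable_EFinP; apply: measurable_funTS.
    apply: (measurableT_comp (f := fun u => dwave u ^+ 2)) => //.
    by apply: measurable_funD => //; exact: measurable_funM.
  - by move=> y _; rewrite lee_fin sqr_ge0.
  - by rewrite lee_fin mulr_ge0// sqr_ge0.
have mbE : measurable_fun (@unit_itv R) (fun x => (bump (cell j x) ^+ 2)%:E).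
  exact/measurable_EFinP.
rewrite ge0_integralZl//; last 2 first.
- by apply: emeasurable_funM.
- by move=> x _; rewrite mule_ge0// lee_fin sqr_ge0.
rewrite ge0_integralZr//; last by move=> x _; rewrite lee_fin sqr_ge0.
apply: (@le_trans _ _ (((k / M) ^+ 2)%:E * ((1 / M)%:E * (36 / M)%:E))%E).
  rewrite lee_wpmul2l ?lee_fin//; apply: lee_pmul => //.
  by apply: integral_ge0 => x _; rewrite lee_fin sqr_ge0.
rewrite -!EFinM lee_fin le_eqVlt; apply/orP; left; apply/eqP.
by field.
Qed.

(** Both densities have mass one, so exactly the integral of the gap is lost. *)
Lemma integral_affinity w j :
  exists2 rho : R, 1 - 36 * k ^+ 2 / M ^+ 4 <= rho &
    (\int[unif_square]_z (affinity w j z)%:E = rho%:E)%E.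
Proof.
have aff0 z : (0 <= (affinity w j z)%:E)%E by rewrite lee_fin affinity_ge0.
have gap0 z : (0 <= (cube_gap w j z)%:E)%E by rewrite lee_fin sqr_ge0.
have mA : measurable_fun setT (fun z => (affinity w j z)%:E).
  by apply/measurable_EFinP; exact: measurable_affinity.
have mG : measurable_fun setT (fun z => (cube_gap w j z)%:E).
  by apply/measurable_EFinP; exact: measurable_cube_gap.
have mD v : measurable_fun setT (fun z => (cube_dens v z)%:E).
  by apply/measurable_EFinP; exact: measurable_cube_dens.
have D0 v z : (0 <= (cube_dens v z)%:E)%E by rewrite lee_fin cube_dens_ge0.
have sum1 : (\int[unif_square]_z (affinity w j z)%:E +
    \int[unif_square]_z (cube_gap w j z)%:E = 1)%E.
  rewrite -ge0_integralD//.
  transitivity (\int[unif_square]_z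
      ((2^-1)%:E * (cube_dens w z)%:E + (2^-1)%:E * (cube_dens (flip j w) z)%:E))%E.
    by apply: eq_integral => z _; rewrite -!EFinM -!EFinD /affinity; congr EFin; field.
  rewrite ge0_integralD//; last 4 first.
  - by move=> z _; rewrite mule_ge0// lee_fin.
  - by apply: emeasurable_funM.
  - by move=> z _; rewrite mule_ge0// lee_fin.
  - by apply: emeasurable_funM.
  rewrite !ge0_integralZl//; try by rewrite lee_fin.
  by rewrite !integral_cube_dens !mule1 -EFinD; congr EFin; field.
have gapb := integral_cube_gap w j.
have gapfin : (\int[unif_square]_z (cube_gap w j z)%:E \is a fin_num)%E.
  by rewrite ge0_fin_numE ?integral_ge0// (le_lt_trans gapb)// ltry.
exists (1 - fine (\int[unif_square]_z (cube_gap w j z)%:E)%E).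
  by rewrite lerD2l lerN2 -lee_fin fineK.
by rewrite EFinB fineK// -sum1 addeK.
Qed.

Definition cube_likelihood w n (t : n.-tuple (R * R)) : R :=
  \prod_(i < n) cube_dens w (tnth t i).

Lemma cube_likelihood_ge0 w n (t : n.-tuple (R * R)) : 0 <= cube_likelihood w t.
Proof. by apply: prodr_ge0 => i _; exact: cube_dens_ge0. Qed.

Lemma measurable_cube_likelihood w n :
  measurable_fun setT (fun t : n.-tuple (R * R) => cube_likelihood w t).
Proof. by apply: measurable_prod_tnth; exact: measurable_cube_dens. Qed.

Lemma integral_cube_law w n (G : n.-tuple (R * R) -> \bar R) :
  measurable_fun setT G -> (forall t, 0 <= G t)%E ->
  (\int[iid_law (joint_law (cube_distr w)) n]_t G t =
   \int[iid_law (@unif_square R) n]_t (G t * (cube_likelihood w t)%:E))%E.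
Proof.
move=> mG G0; apply: ge0_integral_iid_density => //.
- exact: measurable_cube_dens.
- exact: cube_dens_ge0.
Qed.

Lemma integral_cube_likelihood w n :
  (\int[iid_law (@unif_square R) n]_t (cube_likelihood w t)%:E = 1)%E.
Proof.
rewrite integral_iid_prod ?integral_cube_dens.
- by rewrite -EFin_expe expr1n.
- exact: measurable_cube_dens.
- exact: cube_dens_ge0.
Qed.

(** The n-draw affinity is at least 3/4, and [affinity_le_min] gives up 1/2 of it. *)
Lemma integral_min_likelihood w j n : (n <= m ^ 4)%N ->
  ((1/4)%:E <= \int[iid_law (@unif_square R) n]_t
    (Num.min (cube_likelihood w t) (cube_likelihood (flip j w) t))%:E)%E.
Proof.
move=> nm; have [rho rho1 rhoE] := integral_affinity w j.
pose H n (t : n.-tuple (R * R)) := \prod_(i < n) affinity w j (tnth t i).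
have H0 (t : n.-tuple (R * R)) : 0 <= H n t.
  by apply: prodr_ge0 => i _; exact: affinity_ge0.
have HE : (\int[iid_law (@unif_square R) n]_t (H n t)%:E = (rho ^+ n)%:E)%E.
  rewrite integral_iid_prod ?rhoE ?EFin_expe//.
  - exact: measurable_affinity.
  - exact: affinity_ge0.
have rho34 : 3/4 <= rho ^+ n.
  case: n nm {H H0 HE} => [|n] nm; first by rewrite expr0; lra.
  (* One draw loses at most this much affinity, since n <= M^4 and 36 k^2 <= 1/4; Bernoulli's
     inequality then leaves 1 - 1/4 after n draws. *)
  pose t : R := (4 * n.+1%:R)^-1.
  have n0 : 0 < 4 * (n.+1%:R : R) by rewrite mulr_gt0.
  have t1 : 0 <= t <= 1.
    rewrite /t invr_ge0 ltW//= invf_le1//.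
    by rewrite -natr1; have : 0 <= (n%:R : R) by []; lra.
  have rt : 1 - t <= rho.
    apply: le_trans rho1; rewrite lerD2l lerN2 /t.
    rewrite ler_pdivrMr ?exprn_gt0// [X in _ <= X]mulrC ler_pdivlMr//.
    have : (n.+1%:R : R) <= M ^+ 4 by rewrite -natrX ler_nat.
    case/andP: hk => k0 k1; have k2 : k ^+ 2 <= 1/144 by nra.
    have := sqr_ge0 k; move: (M ^+ 4) (n.+1%:R : R) n0 => a b b0; nra.
  have /andP[t0 tle1] := t1.
  apply: le_trans (le_trans (bernoulli_le n.+1 t1) _).
    by rewrite /t invfM mulrCA divff ?pnatr_eq0// mulr1; lra.
  by apply: lerXn2r; rewrite ?nnegrE ?subr_ge0//; apply: le_trans rt; rewrite subr_ge0.
have mL v : measurable_fun setT (fun t : n.-tuple (R * R) => cube_likelihood v t).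
  exact: measurable_cube_likelihood.
have mmin : measurable_fun setT (fun t : n.-tuple (R * R) =>
    Num.min (cube_likelihood w t) (cube_likelihood (flip j w) t)).
  exact: measurable_minr.
have L0 v (t : n.-tuple (R * R)) : 0 <= cube_likelihood v t.
  exact: cube_likelihood_ge0.
have quarter v : (\int[iid_law (@unif_square R) n]_t
    (cube_likelihood v t / 4)%:E = (4^-1)%:E)%E.
  under eq_integral do rewrite mulrC EFinM.
  rewrite ge0_integralZl//.
  - by rewrite integral_cube_likelihood mule1.
  - exact/measurable_EFinP.
  - by move=> t _; rewrite lee_fin.
have mQ v : measurable_fun setT (fun t : n.-tuple (R * R) => (cube_likelihood v t / 4)%:E).
  by apply/measurable_EFinP; exact: measurable_funM.
have Q0 v (t : n.-tuple (R * R)) : (0 <= (cube_likelihood v t / 4)%:E)%E.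
  by rewrite lee_fin divr_ge0.
have min0 (t : n.-tuple (R * R)) :
    (0 <= (Num.min (cube_likelihood w t) (cube_likelihood (flip j w) t))%:E)%E.
  by rewrite lee_fin le_min !L0.
have : ((rho ^+ n)%:E <= \int[iid_law (@unif_square R) n]_t
    ((Num.min (cube_likelihood w t) (cube_likelihood (flip j w) t))%:E +
     ((cube_likelihood w t / 4)%:E + (cube_likelihood (flip j w) t / 4)%:E)))%E.
  rewrite -HE; apply: ge0_le_integral => //.
  - by move=> t _; rewrite lee_fin.
  - apply/measurable_EFinP; apply: measurable_prod_tnth; exact: measurable_affinity.
  - apply: emeasurable_funD; first exact/measurable_EFinP.
    exact: emeasurable_funD.
  - move=> t _; rewrite -!EFinD lee_fin; apply: affinity_le_min => //.
    rewrite /H /cube_likelihood -prodrXl -big_split/=; apply: ler_prod => i _.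
    by rewrite sqr_ge0 affinity_sqr.
have mE : measurable_fun setT (fun t : n.-tuple (R * R) =>
    (Num.min (cube_likelihood w t) (cube_likelihood (flip j w) t))%:E).
  exact/measurable_EFinP.
have mQQ : measurable_fun setT (fun t : n.-tuple (R * R) =>
    (cube_likelihood w t / 4)%:E + (cube_likelihood (flip j w) t / 4)%:E)%E.
  exact: emeasurable_funD.
rewrite ge0_integralD//; last by move=> t _; rewrite adde_ge0.
rewrite ge0_integralD// !quarter -EFinD => hrho.
set I := (X in (_ <= X)%E); move: hrho; rewrite -/I.
(* The integral has not been shown to be finite; the value +oo satisfies the bound trivially. *)
case: I => [r| |]; last by rewrite addNye leeNy_eq.
  by rewrite -EFinD !lee_fin; move: rho34; lra.
by move=> _; rewrite leey.
Qed.

Definition cube_loss w (p : R -> R) x : R :=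
  revenue_loss hk M1 (@cube_profileP R m w) p x.

Lemma cube_loss_pair w j p x : is_pricing p -> `|cell j x| <= 1/2 ->
  k ^+ 2 / (128 * M ^+ 2) <= cube_loss w p x + cube_loss (flip j w) p x.
Proof.
move=> hp jx; have jx1 : `|cell j x| < 1 by apply: le_lt_trans jx _; lra.
have flipN : cube_profile (flip j w) x = - cube_profile w x.
  by rewrite !(cube_profile_in_cell _ jx1) flipE eqxx signrN mulNr.
have v1 : 1/2 <= `|cube_profile w x| <= 1.
  have -> : `|cube_profile w x| = bump (cell j x).
    rewrite (cube_profile_in_cell _ jx1) normrM normr_sign mul1r.
    by rewrite ger0_norm ?bump_ge0.
  by apply/andP; split; [exact: bump_half|exact: bump_le1].
have [y1 [y2 [y1I y2I gain]]] := two_point_gain m_gt0 hk v1.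
have g1 := max_revenue_ge hk M1 (@cube_profileP R m w) x y1I.
have g2 := max_revenue_ge hk M1 (@cube_profileP R m (flip j w)) x y2I.
have := gain (p x); rewrite /cube_loss /revenue_loss; move: g2; rewrite flipN.
move: g1; set a := max_revenue _ _ _ _; set b := max_revenue _ _ _ _; lra.
Qed.

(** The middle half of the cell, where the bump is at least 1/2 as [two_point_gain] demands. *)
Definition half_cell j : set (measurableTypeR R) :=
  `[(2 * j%:R + 1/2) / (2 * M), (2 * j%:R + 3/2) / (2 * M)]%classic.

Lemma half_cellP j x : half_cell j x <-> `|cell j x| <= 1/2.
Proof.
have MM : 0 < 2 * M by rewrite mulr_gt0.
rewrite /half_cell /cell /= in_itv/= ler_pdivrMr// ler_pdivlMr// ler_norml.
by split => /andP[h1 h2]; apply/andP; split; lra.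
Qed.

Lemma half_cell_sub j : half_cell j `<=` unit_itv.
Proof.
have MM : 0 < 2 * M by rewrite mulr_gt0.
have j0 : 0 <= (j%:R : R) by [].
have jm : (j%:R : R) + 1 <= M by rewrite natr1 ler_nat.
move=> x; rewrite /half_cell /= !in_itv/= => /andP[h1 h2]; apply/andP; split.
  by apply: le_trans h1; rewrite divr_ge0// ?ltW//; lra.
by apply: (le_trans h2); rewrite ler_pdivrMr//; lra.
Qed.

Lemma lebesgue_half_cell j : leb (half_cell j) = ((2 * M)^-1)%:E.
Proof.
have MM : 0 < 2 * M by rewrite mulr_gt0.
rewrite lebesgue_measure_itv/= lte_fin ltr_pM2r ?invr_gt0// ifT; last by lra.
by rewrite -EFinB; congr EFin; field.
Qed.

(* Every sample, hence every weighting [q] of the cube, is treated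
   separately: only the total revenue has to be measurable in the data. *)
Lemma cube_weighted_loss (q : {ffun 'I_m -> bool} -> R) p :
  (forall w, 0 <= q w) -> is_pricing p ->
  k ^+ 2 / (512 * M ^+ 3) * (\sum_w \sum_j Num.min (q w) (q (flip j w))) <=
  \sum_w q w * (expected_revenue (opt_price (cube_distr w)) (cube_distr w) -
                expected_revenue p (cube_distr w)).
Proof.
(* [K j] bounds the weighted loss from below at each point of the half cell j. The pairwise constant
   128 becomes 256 because the sum over [w] meets each pair of [w] and [flip j w] twice; the length
   1 / (2 M) of the half cell then produces 512 M^3. *)
move=> q0 hp; pose K j := k ^+ 2 / (256 * M ^+ 2) * \sum_w Num.min (q w) (q (flip j w)).
have min0 w j : 0 <= Num.min (q w) (q (flip j w)) by rewrite le_min !q0.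
have K0 j : 0 <= K j.
  rewrite /K; apply: mulr_ge0; last exact: sumr_ge0.
  apply: divr_ge0; first exact: sqr_ge0.
  exact: mulr_ge0 (ler0n _ _) (sqr_ge0 _).
have mc j : measurable (half_cell j) by exact: measurable_itv.
have mI j : measurable_fun unit_itv (fun x => (\1_(half_cell j) x)%:E : \bar R).
  by apply: measurable_funTS; exact: (measurableT_comp _ (measurable_indic (mc j))).
have mKI j : measurable_fun unit_itv (fun x => ((K j)%:E * (\1_(half_cell j) x)%:E)%E).
  exact: emeasurable_funM.
have KI0 j x : (0 <= (K j)%:E * (\1_(half_cell j) x)%:E)%E.
  by rewrite mule_ge0// lee_fin.
have loss0 w x : unit_itv x -> (0 <= (cube_loss w p x)%:E)%E.
  by move=> x01; rewrite lee_fin; exact: revenue_loss_ge0.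
have mL w : measurable_fun unit_itv (fun x => (cube_loss w p x)%:E).
  by apply/measurable_EFinP; exact: measurable_revenue_loss.
have mqL w : measurable_fun unit_itv (fun x => ((q w)%:E * (cube_loss w p x)%:E)%E).
  exact: emeasurable_funM.
have qL0 w x : unit_itv x -> (0 <= (q w)%:E * (cube_loss w p x)%:E)%E.
  by move=> x01; rewrite mule_ge0 ?lee_fin// -lee_fin loss0.
have -> : k ^+ 2 / (512 * M ^+ 3) * (\sum_w \sum_j Num.min (q w) (q (flip j w))) =
    \sum_j K j * (2 * M)^-1.
  rewrite exchange_big/= mulr_sumr; apply: eq_bigr => j _; rewrite /K.
  by set S := \sum_w _; field.
have lhsE : ((\sum_j K j * (2 * M)^-1)%:E =
    \int[leb]_(x in unit_itv) (\sum_j (K j)%:E * (\1_(half_cell j) x)%:E))%E.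
  rewrite ge0_integral_sum// -sumEFin; apply: eq_bigr => j _.
  rewrite ge0_integralZl//; [|exact: mI|by rewrite lee_fin].
  rewrite integral_indic// setIidl; last exact: half_cell_sub.
  by rewrite EFinM; congr (_ * _)%E; exact/esym/lebesgue_half_cell.
have rhsE : ((\sum_w q w * (expected_revenue (opt_price (cube_distr w)) (cube_distr w) -
      expected_revenue p (cube_distr w)))%:E =
    \int[leb]_(x in unit_itv) (\sum_w (q w)%:E * (cube_loss w p x)%:E))%E.
  rewrite ge0_integral_sum// -sumEFin; apply: eq_bigr => w _.
  rewrite ge0_integralZl//; [|exact: mL|by move=> x; exact: loss0|by rewrite lee_fin].
  by rewrite EFinM expected_lossE.
rewrite -lee_fin lhsE rhsE; apply: ge0_le_integral => //.
- by move=> x _; apply: sume_ge0.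
- exact: emeasurable_sum.
- exact: emeasurable_sum.
move=> x x01.
have -> : (\sum_j (K j)%:E * (\1_(half_cell j) x)%:E = (\sum_j K j * \1_(half_cell j) x)%:E)%E.
  by rewrite -sumEFin.
have -> : (\sum_w (q w)%:E * (cube_loss w p x)%:E = (\sum_w q w * cube_loss w p x)%:E)%E.
  by rewrite -sumEFin.
have l0 w : 0 <= cube_loss w p x by rewrite -lee_fin loss0.
rewrite lee_fin; have [[j jx]|none] := pselect (exists j, half_cell j x); last first.
  rewrite big1 ?sumr_ge0// => [w _|j _]; first by rewrite mulr_ge0.
  by rewrite indicE memNset ?mulr0// => jx; apply: none; exists j.
rewrite (bigD1 j)//= big1 ?addr0 => [|i ij]; last first.
  rewrite indicE memNset ?mulr0// => ix; move/eqP: ij; apply.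
  apply: (@cell_disjoint R m i j x).
    by apply: le_lt_trans (iffLR (half_cellP i x) ix) _; lra.
  by apply: le_lt_trans (iffLR (half_cellP j x) jx) _; lra.
rewrite indicE mem_set// mulr1 /K.
(* The flip is an involution of the cube, so the sum equals the half-sum of itself and its
   reindexing; each term then involves one pair only. *)
have sumE : \sum_w q w * cube_loss w p x =
    2^-1 * \sum_w (q w * cube_loss w p x + q (flip j w) * cube_loss (flip j w) p x).
  rewrite big_split/= [X in _ * (_ + X)](_ : _ = \sum_w q w * cube_loss w p x).
    by field.
  by rewrite [RHS](reindex_inj (inv_inj (flipK j))).
rewrite sumE (_ : k ^+ 2 / (256 * M ^+ 2) = 2^-1 * (k ^+ 2 / (128 * M ^+ 2))); last by field.
rewrite -mulrA ler_wpM2l// mulr_sumr; apply: ler_sum => w _.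
apply: min_mul_le => //; apply: cube_loss_pair => //.
exact/half_cellP.
Qed.

(** If all regrets were below the bound, so would be their average over the cube. But
    [cube_weighted_loss] bounds the likelihood-weighted loss sample by sample, and each of the m
    overlaps integrates to at least 1/4, so the average is at least m * (1/4) * k^2 / (512 m^3) =
    k^2 / (2048 m^2). *)
Lemma cube_regret_lower n (p : n.-tuple (R * R) -> R -> R) : (n <= m ^ 4)%N ->
  (forall data, is_pricing (p data)) ->
  (forall w, measurable_fun setT (fun data => expected_revenue (p data) (cube_distr w))) ->
  exists w, ((k ^+ 2 / (2048 * M ^+ 2))%:E <= regret p (cube_distr w))%E.
Proof.
move=> nm hp mp; apply: contrapT => /forallNP none.
set c := k ^+ 2 / (2048 * M ^+ 2) in none.
pose L w (t : n.-tuple (R * R)) := expected_revenue (opt_price (cube_distr w)) (cube_distr w) -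
  expected_revenue (p t) (cube_distr w).
have L0 w t : 0 <= L w t by exact: expected_loss_ge0.
have mL w : measurable_fun setT (L w) by exact: measurable_funB.
have Q0 w (t : n.-tuple (R * R)) : 0 <= cube_likelihood w t by exact: cube_likelihood_ge0.
have mQ w : measurable_fun setT (fun t : n.-tuple (R * R) => cube_likelihood w t).
  exact: measurable_cube_likelihood.
have QL0 w t : (0 <= (cube_likelihood w t * L w t)%:E)%E.
  by rewrite lee_fin mulr_ge0.
have mQL w : measurable_fun setT (fun t => (cube_likelihood w t * L w t)%:E).
  by apply/measurable_EFinP; exact: measurable_funM.
have rE w : (regret p (cube_distr w) =
    \int[iid_law (@unif_square R) n]_t (cube_likelihood w t * L w t)%:E)%E.
  rewrite (regretE hp (mp w)) integral_cube_law.
  - by apply: eq_integral => t _; rewrite mulrC EFinM.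
  - by apply/measurable_EFinP; exact: mL.
  - by move=> t; rewrite lee_fin; exact: L0.
have r0 w : (0 <= regret p (cube_distr w))%E by rewrite rE; apply: integral_ge0.
have rlt w : (regret p (cube_distr w) < c%:E)%E by rewrite ltNge; apply/negP; exact: none.
have rfin w : regret p (cube_distr w) \is a fin_num.
  by rewrite ge0_fin_numE// (lt_trans (rlt w))// ltry.
have mmin w j : measurable_fun setT (fun t : n.-tuple (R * R) =>
    (Num.min (cube_likelihood w t) (cube_likelihood (flip j w) t))%:E).
  by apply/measurable_EFinP; exact: measurable_minr.
have min0 w j (t : n.-tuple (R * R)) :
    (0 <= (Num.min (cube_likelihood w t) (cube_likelihood (flip j w) t))%:E)%E.
  by rewrite lee_fin le_min !Q0.
have C0 : 0 <= k ^+ 2 / (512 * M ^+ 3).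
  apply: divr_ge0; first exact: sqr_ge0.
  exact: mulr_ge0 (ler0n _ _) (exprn_ge0 _ (ltW Mgt0)).
have sums : (\sum_(w : {ffun 'I_m -> bool}) c%:E <= \sum_w regret p (cube_distr w))%E.
  under [leRHS]eq_bigr do rewrite rE.
  rewrite -ge0_integral_sum//.
  apply: (@le_trans _ _ (\int[iid_law (@unif_square R) n]_t
      ((k ^+ 2 / (512 * M ^+ 3))%:E * \sum_w \sum_j
        (Num.min (cube_likelihood w t) (cube_likelihood (flip j w) t))%:E))%E).
    rewrite ge0_integralZl//; last 2 first.
    - by apply: emeasurable_sum => w; exact: emeasurable_sum.
    - by move=> t _; apply: sume_ge0 => w _; exact: sume_ge0.
    rewrite ge0_integral_sum//; last 2 first.
    - by move=> w; exact: emeasurable_sum.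
    - by move=> w t _; exact: sume_ge0.
    rewrite ge0_sume_distrr; last by move=> w _; apply: integral_ge0 => t _; exact: sume_ge0.
    apply: lee_sum => w _; rewrite ge0_integral_sum//.
    have -> : c%:E = ((k ^+ 2 / (512 * M ^+ 3))%:E * \sum_(j < m) (1/4)%:E)%E.
      rewrite sumEFin sumr_const card_ord -EFinM; congr EFin.
      by rewrite /c -mulr_natr; field.
    by apply: lee_wpmul2l; [rewrite lee_fin|apply: lee_sum => j _; exact: integral_min_likelihood].
  apply: ge0_le_integral; first exact: measurableT.
  - by move=> t _; rewrite mule_ge0 ?lee_fin//; apply: sume_ge0 => w _; exact: sume_ge0.
  - apply: emeasurable_funM => //.
    by apply: emeasurable_sum => w; exact: emeasurable_sum.
  - exact: emeasurable_sum.
  - move=> t _.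
    have := cube_weighted_loss (q := fun w => cube_likelihood w t) (fun w => Q0 w t) (hp t).
    rewrite -lee_fin EFinM -sumEFin -[leRHS]sumEFin.
    by under eq_bigr do rewrite -sumEFin.
(* A point of the cube, needed for the sum of the strict inequalities to be strict. *)
pose w0 : {ffun 'I_m -> bool} := [ffun=> false].
move: sums; rewrite leNgt => /negP; apply.
rewrite (eq_bigr (fun w => (fine (regret p (cube_distr w)))%:E)); last first.
  by move=> w _; rewrite fineK.
rewrite !sumEFin lte_fin; apply: ltr_sum => [|w _].
  by apply/hasP; exists w0; rewrite ?mem_index_enum.
by rewrite -lte_fin fineK.
Qed.

End assouad.

(** Take the least m with n <= m^4. If m >= 2, then (m - 1)^4 < n and m <= 2 (m - 1). *)
Lemma fourth_root_ceil n : (0 < n)%N ->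
  exists m, [/\ (0 < m)%N, (n <= m ^ 4)%N & (m ^ 4 <= 16 * n)%N].
Proof.
move=> n0; have ex : exists m, (n <= m ^ 4)%N.
  by exists n; rewrite -[X in (X <= _)%N]expn1 leq_pexp2l.
case: (ex_minnP ex) => m nm mmin; exists m.
have m0 : (0 < m)%N by case: m nm {mmin} => //; rewrite exp0n// leqNgt n0.
split => //; case: m nm mmin m0 => [//|[|m]] nm mmin _.
  by rewrite exp1n muln_gt0.
have mn : (m.+1 ^ 4 < n)%N by rewrite ltnNge; apply/negP => /mmin; rewrite ltnn.
apply: (@leq_trans ((2 * m.+1) ^ 4)); first by rewrite leq_exp2r// mul2n -addnn addnS !ltnS leq_addr.
by rewrite expnMn leq_mul// ltnW.
Qed.

Theorem theorem4 (R : realType) (C0 Cbar Cbar' Cunder Cstar : R)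
    (hC0 : 0 < C0) (hCbar : 2 < Cbar) (hCbar' : 1 <= Cbar')
    (hCunder : 0 < Cunder <= 1) (hCstar : 0 < Cstar < 2) :
  exists2 c : R, 0 < c &
    \forall n \near \oo,
      ((c / Num.sqrt n%:R)%:E <=
       minimax_regret [set F | regular C0 Cbar Cbar' Cunder Cstar F] n)%E.
Proof.
(* The entries are the slacks in [pert_regular], where they bound 100 k; the entry 1 ensures k <=
   1/100. *)
pose k := Num.min (Num.min 1 C0) (Num.min (2 - Cstar) (Cbar - 2)) / 100.
have [k0 k1 kC0 [kCstar kCbar]] : [/\ 0 < k, k <= 1/100, 100 * k <= C0 &
    100 * k <= 2 - Cstar /\ 100 * k <= Cbar - 2].
  have -> : 100 * k = Num.min (Num.min 1 C0) (Num.min (2 - Cstar) (Cbar - 2)).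
    by rewrite /k mulrC divfK// pnatr_eq0.
  case/andP: hCstar => _ hCstar; split.
  - by rewrite divr_gt0// !lt_min ltr01 hC0 !subr_gt0 hCstar hCbar.
  - by rewrite ler_pM2r ?invr_gt0// !ge_min lexx.
  - by rewrite !ge_min lexx orbT.
  - by rewrite !ge_min !lexx !orbT.
have hk : 0 <= k <= 1/100 by rewrite ltW.
case/andP: hCunder => _ hCu.
(* 8192 = 2048 * 4, since m^4 <= 16 n gives m^2 <= 4 sqrt n. *)
exists (k ^+ 2 / 8192).
  by apply: divr_gt0; [exact: exprn_gt0|rewrite ltr0n].
exists 1%N => // n /= n1.
have [m [m0 nm mn]] := fourth_root_ceil n1.
apply: le_ereal_inf_tmp => _ [p [hp mp] <-].
have reg w : regular C0 Cbar Cbar' Cunder Cstar (cube_distr m0 hk w).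
  exact: pert_regular.
have [w hw] := @cube_regret_lower R m k m0 hk n p nm hp (fun w => mp _ (reg w)).
apply: (@le_trans _ _ (regret p (cube_distr m0 hk w))); last first.
  by apply: ereal_sup_ubound; exists (cube_distr m0 hk w) => //; exact: reg.
apply: le_trans hw; rewrite lee_fin.
have M0 : 0 < m%:R :> R by rewrite ltr0n.
have n0 : 0 < Num.sqrt n%:R :> R by rewrite sqrtr_gt0 ltr0n.
have Mn4 : (m%:R ^+ 2) ^+ 2 <= (4 * Num.sqrt n%:R) ^+ 2 :> R.
  by rewrite [leRHS]exprMn sqr_sqrtr ?ler0n// -exprM -!natrX -natrM ler_nat.
have Mn : m%:R ^+ 2 <= 4 * Num.sqrt n%:R :> R.
  move: Mn4; rewrite ler_pXn2r// nnegrE; first exact: sqr_ge0.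
  by rewrite mulr_ge0// ltW.
rewrite -mulrA -invfM; apply: ler_wpM2l; first exact: sqr_ge0.
rewrite lef_pV2 ?posrE; first by move: Mn; lra.
- by apply: mulr_gt0 n0; rewrite ltr0n.
- by apply: mulr_gt0 (exprn_gt0 _ M0); rewrite ltr0n.
Qed.
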